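(* Let $p>1$, let $n\ge2$ be an integer, and let $K<0$. Then, with $p,n,K$ fixed, $$\bar\lambda_{D,K,n}=(p-1)\left(\frac{\pi_p}{2D}\right)^p+O\!\left(\frac{1}{D^{p-1}}\right)\quad\text{as }D\to0^+,$$ and $$\ln\bar\lambda_{D,K,n}=-(n-1)\sqrt{-K}\cdot D+O(1)\quad\text{as }D\to\infty,$$ where $O(1)$ denotes a quantity bounded independently of $D$.
   Context: Write $a^{(p-1)}:=|a|^{p-2}a$ for real $a$ (with $0^{(p-1)}=0$). For $D>0$, $K<0$, $n\ge2$ (and the fixed $p>1$), $\bar\lambda_{D,K,n}$ denotes the smallest $\bar\lambda>0$ for which the problem $$\frac{d}{dt}\big(\dot w^{(p-1)}\big)+(n-1)\sqrt{-K}\,\dot w^{(p-1)}+\bar\lambda\, w^{(p-1)}=0\ \text{ on }[0,D],\qquad w(0)=0,\ \dot w(D)=0,$$ has a nontrivial solution $w$ (with $w$ and $\dot w^{(p-1)}$ of class $C^1$); such a smallest value exists. The constant $\pi_p$ is $$\pi_p:=2\int_0^1\frac{dt}{(1-t^p)^{1/p}}=\frac{2\pi}{p\sin(\pi/p)}.$$ The constants implied in the $O(\cdot)$ terms may depend on $p,n,K$ but not on $D$. *)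

(* Defs.v *)
From mathcomp Require Import all_boot all_order all_algebra.
From mathcomp Require Import all_classical all_reals all_analysis.

Set Implicit Arguments.
Unset Strict Implicit.
Unset Printing Implicit Defensive.

Import Order.TTheory GRing.Theory Num.Theory.
Import numFieldNormedType.Exports.

Local Open Scope classical_set_scope.
Local Open Scope ring_scope.

Definition spow (R : realType) (p a : R) : R := `|a| `^ (p - 2) * a.

(* [df] is the derivative of [f] relative to [A] and is continuous on [A]. For
   [A = `[0, D]] the difference quotients only see points of the interval, so
   the derivatives at 0 and D are one-sided; values outside [A] are irrelevant. *)
Definition C1_on (R : realType) (A : set R) (f df : R -> R) : Prop :=
  (forall t, A t -> (f s - f t) / (s - t) @[s --> within A t^'] --> df t) /\
  {within A, continuous df}.

(* [dw] and [dv] stand for w' and (w'^(p-1))'. *)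
Definition eigenfunction (R : realType) (p : R) (n : nat) (K D lam : R)
    (w : R -> R) : Prop :=
  exists dw dv : R -> R,
    [/\ C1_on `[0, D] w dw,
        C1_on `[0, D] (fun t => spow p (dw t)) dv,
        forall t : R, t \in `[0, D] ->
          dv t + (n%:R - 1) * Num.sqrt (- K) * spow p (dw t)
            + lam * spow p (w t) = 0,
        w 0 = 0 /\ dw D = 0 &
        exists2 t : R, t \in `[0, D] & w t != 0].

Definition pos_eigenvalues (R : realType) (p : R) (n : nat) (K D : R) : set R :=
  [set lam | 0 < lam /\ exists w, eigenfunction p n K D lam w].

(* The least positive eigenvalue; the default value 0 would only be taken if
   the set of positive eigenvalues had no least element. *)
Definition lambda_bar (R : realType) (p : R) (n : nat) (K D : R) : R :=
  xget 0 (pos_eigenvalues p n K D `&` lbound (pos_eigenvalues p n K D)).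

Definition pi_p (R : realType) (p : R) : R :=
  2 * Rintegral lebesgue_measure `[0, 1] (fun t : R => ((1 - t `^ p) `^ p^-1)^-1).

(* Lets [pinfty_nbhs R] be used as the filter of a big-O. *)
Canonical pinfty_filter_on (R : realType) :=
  FilterType (pinfty_nbhs R) _.

(* Main.v *)
(* With c = (n - 1) sqrt(- K) and q = p / (p - 1), the Riccati variable
   u = (w' / w)^(p-1) of a positive increasing solution w satisfies the
   autonomous equation u' = - (lam + c u + (p - 1) u^q), and decreases from +oo
   at t = 0 to 0 at t = D; hence D is an explicit integral of lam.  Writing
   lam = eps^(-p) and compactifying the range of u by
   u = eps^(1-p) (1 - s) / s^(p-1) with s in [0, 1], this reads
   D = eps J(c eps), where
     J(b) = int_0^1 ((p - 1)(1 - s) + s)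
                    / (s^p + b s (1 - s) + (p - 1)(1 - s)^q) ds.
   Conversely, w is recovered from s by a quadrature, so eps^(-p) is an
   eigenvalue, and Picone's identity with this u excludes smaller positive
   ones; thus lambda_bar = eps^(-p).  The behaviour for D -> 0 follows from J
   being Lipschitz with J(0) = (p-1)^(1/p) pi_p / 2, and the one for D -> oo
   from b J(b) = p ln b + O(1). *)

Require Import Defs.
From mathcomp Require Import all_boot all_order all_algebra.
From mathcomp Require Import all_classical all_reals all_analysis.
From mathcomp Require Import measurable_realfun ring lra.

Set Implicit Arguments.
Unset Strict Implicit.
Unset Printing Implicit Defensive.

Import Order.TTheory GRing.Theory Num.Theory.
Import numFieldNormedType.Exports.
Local Open Scope classical_set_scope.
Local Open Scope ring_scope.

(** * One-variable calculus on segments *)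

Lemma cvg_within_epsdelta (R : realType) (A : set R) (f : R -> R) (t l : R) :
  f s @[s --> within A (nbhs t)] --> l <->
  forall e : R, 0 < e -> exists2 d : R, 0 < d &
    forall s, A s -> `|s - t| < d -> `|f s - l| < e.
Proof.
split=> [/cvgrPdist_lt h e e0|h].
- have := h e e0; rewrite near_withinE => -[d /= d0 hd]; exists d => // s As sd.
  by rewrite distrC; apply: (hd s) => //=; rewrite distrC.
- apply/cvgrPdist_lt => e e0; rewrite near_withinE.
  have [d d0 hd] := h e e0; exists d => // s /= sd As.
  by rewrite distrC; apply: hd => //; rewrite distrC.
Qed.

Lemma cvg_dnbhs_within_epsdelta (R : realType) (A : set R) (f : R -> R)
    (t l : R) :
  f s @[s --> within A t^'] --> l <->
  forall e : R, 0 < e -> exists2 d : R, 0 < d &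
    forall s, A s -> s != t -> `|s - t| < d -> `|f s - l| < e.
Proof.
split=> [/cvgrPdist_lt h e e0|h].
- have := h e e0; rewrite near_withinE => -[d /= d0 hd]; exists d => //.
  move=> s As st sd.
  by rewrite distrC; apply: (hd s) => //=; rewrite distrC.
- apply/cvgrPdist_lt => e e0; rewrite near_withinE.
  have [d d0 hd] := h e e0; exists d => // s /= sd st As.
  by rewrite distrC; apply: hd => //; rewrite distrC.
Qed.

Lemma within_continuous_epsdelta (R : realType) (A : set R) (f : R -> R) :
  {within A, continuous f} <->
  forall t, A t -> forall e : R, 0 < e -> exists2 d : R, 0 < d &
    forall s, A s -> `|s - t| < d -> `|f s - f t| < e.
Proof.
rewrite subspace_continuousP; split=> h t At; first exact/cvg_within_epsdelta/h.
exact/cvg_within_epsdelta/h.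
Qed.

Lemma nbhs_itvoo (R : realType) (a b t : R) :
  t \in `]a, b[ -> exists2 d : R, 0 < d &
    forall s, `|s - t| < d -> s \in `]a, b[.
Proof.
move=> tab; exists (Num.min (t - a) (b - t)).
  by rewrite lt_min !subr_gt0 !(itvP tab).
move=> s; rewrite lt_min !ltr_distl => /andP[/andP[h _] /andP[_ k]].
by rewrite in_itv /=; apply/andP; split; lra.
Qed.

(** Near an interior point the restriction to the segment is invisible, so the difference quotient,
    completed by [df t] at [t], is a continuous slope function in the sense of Carathéodory. *)
Lemma C1_on_is_derive (R : realType) (a b : R) (f df : R -> R) :
  C1_on `[a, b] f df -> forall t, t \in `]a, b[ -> is_derive t 1 f (df t).
Proof.
move=> [fdf _] t tab; apply/is_derive1_caratheodory.
exists (fun z => if z == t then df t else (f z - f t) / (z - t)); split.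
- move=> z; case: eqVneq => [->|zt]; first by rewrite !subrr mulr0.
  by rewrite divfK// subr_eq0.
- have /fdf /cvg_dnbhs_within_epsdelta h : [set` `[a, b]] t.
    by rewrite /= in_itv /= !ltW ?(itvP tab).
  apply/cvgrPdist_lt => e e0; have [d d0 hd] := h e e0.
  have [d' d'0 hd'] := nbhs_itvoo tab.
  exists (Num.min d d'); first by rewrite /= lt_min d0.
  move=> s /=; rewrite distrC lt_min eqxx => /andP[sd sd'].
  case: eqVneq => [_|st]; first by rewrite subrr normr0.
  rewrite distrC; apply: hd => //=.
  by have := hd' _ sd'; rewrite !in_itv /= => /andP[/ltW -> /ltW ->].
- by rewrite eqxx.
Qed.

Lemma C1_on_continuous (R : realType) (A : set R) (f df : R -> R) :
  C1_on A f df -> {within A, continuous f}.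
Proof.
move=> [fdf _]; apply/within_continuous_epsdelta => t At e e0.
have /cvg_dnbhs_within_epsdelta /(_ 1 ltr01)[d d0 hd] := fdf t At.
pose C := `|df t| + 1.
have C0 : 0 < C by rewrite /C ltr_wpDl.
exists (Num.min d (e / C)); first by rewrite lt_min d0 divr_gt0.
move=> s As; rewrite lt_min => /andP[sd se].
have [->|st] := eqVneq s t; first by rewrite subrr normr0.
have st0 : s - t != 0 by rewrite subr_eq0.
have := hd s As st sd; set r := (_ / _) => hr.
have -> : f s - f t = r * (s - t) by rewrite divfK.
have rC : `|r| <= C.
  by rewrite -(subrK (df t) r) addrC (le_trans (ler_normD _ _))// lerD2l ltW.
rewrite normrM; apply: le_lt_trans (_ : C * `|s - t| < _).
  by rewrite ler_wpM2r.
by rewrite mulrC -ltr_pdivlMr.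
Qed.

Lemma MVT_subitv (R : realType) (a b x y : R) (f df : R -> R) :
  {within `[a, b], continuous f} ->
  (forall t, t \in `]a, b[ -> is_derive t 1 f (df t)) ->
  a <= x -> x <= y -> y <= b ->
  exists2 c, c \in `[x, y] & f y - f x = df c * (y - x).
Proof.
move=> cf fdf ax xy yb.
have H1 z : z \in `]x, y[ -> is_derive z 1 f (df z).
  by move=> zxy; apply: fdf; apply: subset_itv zxy; rewrite bnd_simp.
have H2 : {within `[x, y], continuous f}.
  by apply: continuous_subspaceW cf; apply: subset_itv; rewrite bnd_simp.
exact: MVT_segment xy H1 H2.
Qed.

(** By the mean value theorem a difference quotient at [t] is a value of [df] between [s] and [t].
    Continuity of [df] then yields the one-sided derivatives at the endpoints as well, so only
    interior derivatives need computing. *)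
Lemma C1_on_itv (R : realType) (a b : R) (f df : R -> R) :
  {within `[a, b], continuous f} -> {within `[a, b], continuous df} ->
  (forall t, t \in `]a, b[ -> is_derive t 1 f (df t)) -> C1_on `[a, b] f df.
Proof.
move=> cf cdf fdf; split => // t tab; apply/cvg_dnbhs_within_epsdelta => e e0.
have /within_continuous_epsdelta /(_ t tab e e0)[d d0 hd] := cdf.
exists d => // s sab st sd.
suff [c cab] : exists2 c, c \in `[Num.min s t, Num.max s t] &
    f s - f t = df c * (s - t).
  move=> ->; rewrite mulfK ?subr_eq0//; apply: hd.
    move: cab sab tab; rewrite /= !in_itv /= ge_min le_max => /andP[].
    by move=> /orP[] ? /orP[] ? /andP[? ?] /andP[? ?]; apply/andP; split; lra.
  move: cab sd; rewrite !in_itv /= ge_min le_max !ltr_norml.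
  move=> /andP[/orP[] ? /orP[] ?] /andP[? ?];
  by apply/andP; split; lra.
have mvt x y := @MVT_subitv R a b x y f df cf fdf.
move: tab sab; rewrite /= !in_itv /= => /andP[ta tb] /andP[sa sb].
move: st; rewrite neq_lt => /orP[st|ts].
  have [c cs E] := mvt _ _ sa (ltW st) tb; exists c.
    by rewrite min_l ?max_r ?(ltW st).
  by apply: oppr_inj; rewrite opprB E -mulrN opprB.
have [c cs E] := mvt _ _ ta (ltW ts) sb; exists c => //.
by rewrite min_r ?max_l ?(ltW ts).
Qed.

(** The difference [g - f] is nondecreasing. Applied to primitives, this is how the integrals below
    are compared. *)
Lemma ler_increment (R : realType) (a b : R) (f g df dg : R -> R) : a <= b ->
  {within `[a, b], continuous f} -> {within `[a, b], continuous g} ->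
  (forall t, t \in `]a, b[ -> is_derive t 1 f (df t)) ->
  (forall t, t \in `]a, b[ -> is_derive t 1 g (dg t)) ->
  (forall t, t \in `]a, b[ -> df t <= dg t) ->
  f b - f a <= g b - g a.
Proof.
move=> ab cf cg fdf gdg le_dfdg.
have h t : t \in `]a, b[ -> is_derive t 1 (g - f) (dg t - df t).
  by move=> tab; apply: is_deriveB; [exact: gdg|exact: fdf].
suff : (g - f) a <= (g - f) b by rewrite !fctE; lra.
apply: (@ger0_derive1_ndecr _ _ a b) => //.
- by move=> x /h[].
- move=> x xab; rewrite derive1E; have [_ ->] := h x xab.
  by rewrite subr_ge0 le_dfdg.
- by move=> x; apply: cvgB; [exact: cg|exact: cf].
Qed.

Definition primitive (R : realType) (f : R -> R) (x : R) : R :=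
  \int[lebesgue_measure]_(t in `[0, x]) f t.

Section primitive.
Variables (R : realType) (b : R) (f : R -> R).
Hypotheses (b0 : 0 < b) (cf : {within `[0, b], continuous f}).

Let intf : (@lebesgue_measure R).-integrable `[0, b] (EFin \o f).
Proof.
by apply: continuous_compact_integrable; first exact: segment_compact.
Qed.

Lemma primitive0 : primitive f 0 = 0.
Proof. by rewrite /primitive set_itv1 Rintegral_set1. Qed.

Lemma primitive_continuous : {within `[0, b], continuous (primitive f)}.
Proof. exact: parameterized_integral_continuous (ltW b0) intf. Qed.

Lemma is_derive_primitive t : t \in `]0, b[ ->
  is_derive t 1 (primitive f) (f t).
Proof.
move=> tab; have [] := @continuous_FTC1_closed _ f 0 t b.
- by rewrite (itvP tab).
- exact: intf.
- by rewrite (itvP tab).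
- exact: within_continuous_continuous cf tab.
by rewrite -/(primitive f) derive1E => d <-; exact: derivableP.
Qed.

End primitive.

(** A positive derivative makes [T] strictly increasing and the intermediate value theorem makes it
    onto. It serves both to invert the time map and to change variables in the integral defining
    [pi_p]. *)
Lemma inverse_segment (R : realType) (a b : R) (T g : R -> R) : a < b ->
  {within `[a, b], continuous T} ->
  (forall s, s \in `]a, b[ -> is_derive s 1 T (g s)) ->
  (forall s, s \in `]a, b[ -> 0 < g s) ->
  exists S : R -> R,
  [/\ forall t, S t \in `[a, b],
      {in `[T a, T b], cancel S T} /\ {in `[a, b], cancel T S},
      {within `[T a, T b], continuous S} &
      forall t, t \in `]T a, T b[ ->
        (S t \in `]a, b[) /\ is_derive t 1 S (g (S t))^-1].
Proof.
move=> ab cT dT g0.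
have Tlt : {in `[a, b] &, {homo T : x y / x < y}}.
  apply: gtr0_derive1_lt_cc => //; first by move=> x /dT[].
  by move=> x xab; rewrite derive1E; have [_ ->] := dT x xab; exact: g0.
have Tinj : {in `[a, b] &, injective T}.
  move=> x y xab yab Txy; case: (ltgtP x y) => // xy.
    by have := Tlt _ _ xab yab xy; rewrite Txy ltxx.
  by have := Tlt _ _ yab xab xy; rewrite Txy ltxx.
have aab : a \in `[a, b] by rewrite in_itv /= lexx ltW.
have bab : b \in `[a, b] by rewrite in_itv /= lexx ltW.
have TaTb : T a <= T b by exact/ltW/Tlt.
(* The default value [a] keeps [S t] in the segment for every real [t], even outside the range of
   [T]. *)
pose S t := xget a (fun s => s \in `[a, b] /\ T s = t).
have SP t : t \in `[T a, T b] -> S t \in `[a, b] /\ T (S t) = t.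
  move=> tab; have [|c cab Tc] := @IVT R T a b t (ltW ab) cT.
    by rewrite min_l// max_r// !(itvP tab).
  by rewrite /S; case: xgetP => [y ->|/(_ c)/not_andP[]].
have TS : {in `[a, b], cancel T S}.
  move=> s sab; rewrite /S.
  case: xgetP => [y _ [yab /Tinj]|/(_ s)/not_andP[]//].
  exact.
have cS : {within `[T a, T b], continuous S}.
  exact: segment_can_le_continuous (ltW ab) cT TS.
exists S; split => //.
- move=> t; rewrite /S; case: xgetP => [y _ []//|_].
  exact: aab.
- by split => // t /SP[].
move=> t tab; have [|Sab TSt] := SP t; first exact: subset_itv_oo_cc.
have Sab' : S t \in `]a, b[.
  move: Sab; rewrite !in_itv /= !le_eqVlt => /andP[/orP[/eqP aS|->]].
    by move: tab; rewrite -TSt -aS in_itv /= ltxx.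
  move=> /orP[/eqP Sb|//].
  by move: tab; rewrite -TSt Sb in_itv /= ltxx andbF.
split => //; rewrite -{1}TSt; apply: is_derive_inverse.
- near=> z; apply: TS; apply: subset_itv_oo_cc; near: z.
  exact: near_in_itvoo.
- near=> z; apply/differentiable_continuous/derivable1_diffP.
  suff : z \in `]a, b[ by move/dT; case.
  by near: z; exact: near_in_itvoo.
- exact: dT.
- by rewrite gt_eqF// g0.
Unshelve. all: by end_near. Qed.

(** An improper fundamental theorem: [f] may blow up at [b], as the integrand of [pi_p] does at 1.
    The segments from [a] to [u n] exhaust the half-open interval; monotone convergence handles the
    integrals and continuity of [F] at [b] the increments. *)
Lemma Rintegral_ge0_FTC2 (R : realType) (a b : R) (f F : R -> R) : a < b ->
  (forall x, x \in `[a, b[ -> 0 <= f x) ->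
  {within `[a, b[, continuous f} ->
  {within `[a, b], continuous F} ->
  (forall x, x \in `]a, b[ -> is_derive x 1 F (f x)) ->
  \int[lebesgue_measure]_(x in `[a, b]) f x = F b - F a.
Proof.
move=> ab f0 cf cF dF.
(* The shift by 2 rather than 1 gives [a < u n] already for [n = 0]. *)
pose u n : R := b - (b - a) / n.+2%:R.
have ba0 : 0 < b - a by rewrite subr_gt0.
have au n : a < u n.
  rewrite /u ltrBrDl -ltrBrDr ltr_pdivrMr// ltr_pMr//.
  by rewrite (_ : 1 = 1%:R)// ltr_nat.
have ub n : u n < b by rewrite /u gtrBl divr_gt0.
have cu : u n @[n --> \oo] --> b.
  rewrite -[X in _ --> X]subr0; apply: cvgB; first exact: cvg_cst.
  rewrite -(mulr0 (b - a)); apply: cvgMr.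
  have := @cvg_harmonic R; rewrite -cvg_shiftS /=; exact.
have cfu n : {within `[a, u n], continuous f}.
  by apply: continuous_subspaceW cf; apply: subset_itvl; rewrite bnd_simp.
have cFu n : {within `[a, u n], continuous F}.
  by apply: continuous_subspaceW cF; apply: subset_itvl; rewrite bnd_simp ltW.
have FTC n : (\int[lebesgue_measure]_(x in `[a, u n]) (f x)%:E =
              (F (u n))%:E - (F a)%:E)%E.
  have dFu x : x \in `]a, u n[ -> is_derive x 1 F (f x).
    by move=> xau; apply: dF; apply: subset_itvl xau; rewrite bnd_simp ltW.
  apply: continuous_FTC2 => //.
    have /(continuous_within_itvP _ (au n))[_ h1 h2] := cFu n.
    by split => // x /dFu[].
  by move=> x xau; rewrite derive1E; have [_ ->] := dFu x xau.
have bigU : \bigcup_n `[a, u n]%classic = `[a, b[%classic.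
  apply/seteqP; split => [x [n _]|x] /=; rewrite !in_itv /=.
    by move=> /andP[-> /le_lt_trans]; apply.
  move=> /andP[ax xb].
  have [n _ /(_ n (leqnn n)) hn] : \forall n \near \oo, x < u n.
    exact: (cvgr_gt _ cu).
  by exists n => //=; rewrite in_itv /= ax ltW.
have mf : measurable_fun `[a, b[ f.
  by apply: subspace_continuous_measurable_fun => //; exact: measurable_itv.
have lim1 : (\int[lebesgue_measure]_(x in `[a, u n]) (f x)%:E @[n --> \oo] -->
    \int[lebesgue_measure]_(x in `[a, b[) (f x)%:E)%E.
  rewrite -bigU; apply: ge0_nondecreasing_set_cvg_integral => //.
  - move=> n m nm; rewrite subsetEset; apply: subset_itvl.
    rewrite bnd_simp /u lerD2l lerN2 ler_pM2l// lef_pV2 ?posrE//.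
    by rewrite ler_nat !ltnS.
  - move=> n; apply/measurable_EFinP; apply: measurable_funS mf.
      exact: measurable_itv.
    by apply: subset_itvl; rewrite bnd_simp.
  - move=> n x /= xau; rewrite lee_fin; apply: f0; move: xau.
    by rewrite !in_itv /= => /andP[-> /le_lt_trans]; apply.
have lim2 : (\int[lebesgue_measure]_(x in `[a, u n]) (f x)%:E @[n --> \oo] -->
    (F b - F a)%:E)%E.
  under eq_cvg do rewrite FTC -EFinB.
  apply: cvg_EFin; first exact: nearW.
  apply: cvgB; last exact: cvg_cst.
  have /(continuous_within_itvP _ ab)[_ _ Fb] := cF.
  by move/cvg_at_leftP : Fb; apply; split.
rewrite /Rintegral -integral_itv_bndo_bndc; last exact/measurable_EFinP.
by rewrite (cvg_unique _ lim1 lim2).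
Qed.

(** * The function a^(p-1) and Picone's identity *)

Section spow.
Variables (R : realType) (p : R).
Hypothesis p1 : 1 < p.
Implicit Types a b u x : R.

Let p0 : 0 < p. Proof. exact: lt_trans p1. Qed.
Let p0' : p != 0. Proof. by rewrite gt_eqF. Qed.

Lemma spow0 : spow p 0 = 0.
Proof. by rewrite /spow mulr0. Qed.

Lemma ge0_spow a : 0 <= a -> spow p a = a `^ (p - 1).
Proof.
rewrite le_eqVlt => /predU1P[<-|a0].
  by rewrite spow0 powR0// subr_eq0 gt_eqF.
rewrite /spow gtr0_norm// -[X in _ * X]powRr1 ?ltW// -powRD; last first.
  by rewrite (gt_eqF a0) implybT.
by congr (_ `^ _); ring.
Qed.

Lemma spowN a : spow p (- a) = - spow p a.
Proof. by rewrite /spow normrN mulrN. Qed.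

Lemma norm_spow a : `|spow p a| = `|a| `^ (p - 1).
Proof.
rewrite -ge0_spow// /spow normr_id normrM ger0_norm ?powR_ge0//.
Qed.

Lemma mul_spow a : a * spow p a = `|a| `^ p.
Proof.
rewrite -(@mulr_powRB1 _ `|a|)// -norm_spow /spow normrM.
rewrite [X in _ = _ * (X * _)]ger0_norm ?powR_ge0//.
by rewrite 2!(mulrCA _ (_ `^ _)) -!expr2 real_normK ?num_real.
Qed.

(** Away from 0 this is the power rule on either half-line. At 0 the slope function is [spow p]
    itself, because |z|^p = z [spow p z], and it is continuous there since p > 1. *)
Lemma is_derive_norm_powR x :
  is_derive x 1 (fun y => `|y| `^ p) (p * spow p x).
Proof.
have [x0|x0|->] := ltgtP x 0.
- have -> : p * spow p x = p * (- x) `^ (p - 1) * -1.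
    by rewrite -ge0_spow ?oppr_ge0 ?ltW// spowN mulrN1 mulrN opprK.
  apply: (@near_eq_is_derive _ _ _ (fun y : R => (- y) `^ p)) => //.
    near=> y; rewrite ltr0_norm//; near: y; exact: lt_nbhsl.
  apply: (@is_derive1_comp _ (@powR R ^~ p) -%R).
  by apply: is_derive1_powR; rewrite oppr_gt0.
- rewrite ge0_spow ?ltW//.
  apply: (@near_eq_is_derive _ _ _ (fun y : R => y `^ p)) => //.
    near=> y; rewrite gtr0_norm//; near: y; exact: lt_nbhsr.
  exact: is_derive1_powR.
- rewrite spow0 mulr0; apply/is_derive1_caratheodory; exists (spow p); split.
  + by move=> z; rewrite normr0 powR0// !subr0 mulrC mul_spow.
  + apply/cvgrPdist_lt => e e0.
    exists (e `^ (p - 1)^-1); first by rewrite /= powR_gt0.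
    move=> z /=; rewrite sub0r normrN => zd.
    rewrite spow0 sub0r normrN norm_spow.
    have -> : e = (e `^ (p - 1)^-1) `^ (p - 1).
      by rewrite -powRrM mulVf ?powRr1 ?(ltW e0)// subr_eq0 gt_eqF.
    by apply: gt0_ltr_powR; rewrite ?subr_gt0 ?nnegrE ?powR_ge0.
  + exact: spow0.
Unshelve. all: by end_near. Qed.

(** Young's inequality with exponents p and q = p/(p-1) for the factors |a| and |b|^(p-1) u,
    multiplied by p; note (p-1) q = p. It is used with a = w' and b = w. *)
Lemma young_spow a b u : 0 <= u ->
  p * spow p b * a * u <= `|a| `^ p + (p - 1) * `|b| `^ p * u `^ (p / (p - 1)).
Proof.
move=> u0; have pm0 : 0 < p - 1 by rewrite subr_gt0.
have q0 : 0 < p / (p - 1) by rewrite divr_gt0.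
have := @conjugate_powR R `|a| (`|b| `^ (p - 1) * u) p (p / (p - 1)).
rewrite normr_ge0 mulr_ge0 ?powR_ge0// p0 q0 => /(_ isT isT isT isT) h.
have {h} := h _; rewrite powRM ?powR_ge0// -powRrM.
have -> : (p - 1) * (p / (p - 1)) = p by field; rewrite gt_eqF.
move=> h; have {h} : `|a| * (`|b| `^ (p - 1) * u) <=
    `|a| `^ p / p + `|b| `^ p * u `^ (p / (p - 1)) / (p / (p - 1)).
  by apply: h; field; rewrite p0' gt_eqF.
rewrite -(ler_pM2l p0) mulrDr [p * (_ / p)]mulrC divfK//.
move=> h; apply: (@le_trans _ _ (p * (`|a| * (`|b| `^ (p - 1) * u)))).
  rewrite -norm_spow -2!mulrA ler_pM2l//.
  rewrite [X in _ <= X](_ : _ = `|spow p b * (a * u)|) ?ler_norm//.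
  by rewrite !normrM (ger0_norm u0); ring.
apply: le_trans h _; rewrite lerD2l le_eqVlt; apply/orP; left; apply/eqP.
by field; rewrite p0' gt_eqF.
Qed.

End spow.

(* The function expR (c t) (w w'^(p-1) - |w|^p u) vanishes at both ends and, by
   Young's inequality, its derivative is at least
   expR (c t) (Lam - lam) |w|^p. *)
Lemma picone_eq0 (R : realType) (p c D lam Lam C : R) (w dw dv u : R -> R) :
  1 < p -> 0 < D -> lam < Lam ->
  C1_on `[0, D] w dw -> C1_on `[0, D] (fun t => spow p (dw t)) dv ->
  (forall t, t \in `[0, D] ->
     dv t + c * spow p (dw t) + lam * spow p (w t) = 0) ->
  w 0 = 0 -> dw D = 0 ->
  (forall t, t \in `]0, D[ -> 0 <= u t) ->
  (forall t, t \in `]0, D[ ->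
     is_derive t 1 u (- (Lam + c * u t + (p - 1) * u t `^ (p / (p - 1))))) ->
  u D = 0 -> u s @[s --> D^'-] --> 0 ->
  (forall t, t \in `]0, D[ -> u t * t `^ (p - 1) <= C) ->
  forall t, t \in `[0, D] -> w t = 0.
Proof.
move=> p1 D0 lL wC1 vC1 eqn w0 dwD u0 du uD uDl uC.
have p0 : 0 < p by exact: lt_trans p1.
have p0' : p != 0 by rewrite gt_eqF.
have wd := C1_on_is_derive wC1.
have vd := C1_on_is_derive vC1.
have /(continuous_within_itvP _ D0)[_ w0r wDl] := C1_on_continuous wC1.
have /(continuous_within_itvP _ D0)[_ v0r vDl] := C1_on_continuous vC1.
have cnp x : {for x, continuous (fun y : R => `|y| `^ p)}.
  apply/differentiable_continuous/derivable1_diffP.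
  by have [] := is_derive_norm_powR p1 x.
pose H t := `|w t| `^ p * u t.
pose G t := expR (c * t) * (w t * spow p (dw t) - H t).
(* This is the derivative of [G] once the equations for [w] and [u] are inserted: all terms with [c]
   cancel, and what is left is grouped so that Young's inequality applies to the inner bracket. *)
pose dG t := expR (c * t) * ((Lam - lam) * `|w t| `^ p +
  (`|dw t| `^ p + (p - 1) * `|w t| `^ p * u t `^ (p / (p - 1)) -
    p * spow p (w t) * dw t * u t)).
have dGP t : t \in `]0, D[ -> is_derive t 1 G (dG t).
  move=> tD.
  have e1 : is_derive t 1 (fun s => expR (c * s)) (expR (c * t) * c).
    apply: (@is_derive1_comp _ expR ( *%R c)).
    by apply: is_derive_eq; rewrite [LHS]mulr1.
  have h1 : is_derive t 1 (fun s => `|w s| `^ p) (p * spow p (w t) * dw t).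
    apply: (@is_derive1_comp _ (fun y : R => `|y| `^ p) w).
      exact: is_derive_norm_powR.
    exact: wd.
  have h2 := is_deriveM h1 (du t tD).
  have h3 := is_deriveM (wd t tD) (vd t tD).
  have h4 := is_deriveM e1 (is_deriveB h3 h2).
  apply: is_derive_eq h4 _; rewrite /dG !fctE /GRing.scale /=.
  have tD' : t \in `[0, D] by exact: subset_itv_oo_cc.
  have -> : dv t = - c * spow p (dw t) - lam * spow p (w t).
    by have := eqn t tD'; lra.
  rewrite -(mul_spow p1 (dw t)) -(mul_spow p1 (w t)) /=.
  by ring.
have dG0 t : t \in `]0, D[ ->
    (Lam - lam) * `|w t| `^ p <= dG t * expR (- (c * t)).
  move=> tD; rewrite /dG mulrAC -expRD subrr expR0 mul1r lerDl subr_ge0.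
  by apply: young_spow => //; exact: u0.
have dG_ge0 t : t \in `]0, D[ -> 0 <= dG t.
  move=> tD; rewrite -(pmulr_lge0 _ (expR_gt0 (- (c * t)))).
  by apply: le_trans (dG0 _ tD); rewrite mulr_ge0 ?powR_ge0// subr_ge0 ltW.
(* The one-sided derivative of [w] at 0 gives |w s| <= L s nearby. With u s^(p-1) <= C this makes
   |w|^p u of order s, so [H] tends to 0 although [u] may be unbounded at 0. *)
have [L L0 [d d0 wL]] : exists2 L, 0 <= L & exists2 d : R, 0 < d &
    forall s, 0 < s -> s < d -> `|w s| <= L * s.
  have [h _] := wC1.
  have /h /cvg_dnbhs_within_epsdelta /(_ 1 ltr01)[d d0 hd] :
      [set` `[0, D]] (0 : R).
    by rewrite /= in_itv /= lexx ltW.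
  exists (`|dw 0| + 1); first by rewrite addr_ge0.
  exists (Num.min d D); first by rewrite lt_min d0.
  move=> s s0; rewrite lt_min => /andP[sd sD].
  have := hd s; rewrite w0 !subr0 => /(_ _ _ _)/ltW h1.
  have {}h1 : `|w s / s - dw 0| <= 1.
    by apply: h1; rewrite ?gt_eqF ?gtr0_norm//= in_itv /= !ltW.
  rewrite -ler_pdivrMr// -[X in _ / X]gtr0_norm// -normfV -normrM.
  rewrite -(subrK (dw 0) (w s / s)) addrC.
  by apply: le_trans (ler_normD _ _) _; rewrite lerD2l.
have H0 : H 0 = 0 by rewrite /H w0 normr0 powR0// mul0r.
have H0r : H s @[s --> 0^'+] --> 0.
  pose B s : R := (L `^ p * C) * s.
  apply: (@squeeze_cvgr _ _ _ _ (fun=> 0) B).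
  - near=> s.
    have s0 : 0 < s by [].
    have sD : s \in `]0, D[ by rewrite in_itv /= s0 /=.
    rewrite /H /B mulr_ge0 ?powR_ge0 ?u0//=.
    apply: (@le_trans _ _ ((L * s) `^ p * u s)).
      rewrite ler_wpM2r ?u0//.
      apply: ge0_ler_powR; rewrite ?nnegrE ?normr_ge0//.
      - exact: ltW.
      - by rewrite mulr_ge0// ltW.
      - exact: wL.
    rewrite powRM ?(ltW s0)// -(@mulr_powRB1 _ s p) ?(ltW s0)//.
    have -> : L `^ p * (s * s `^ (p - 1)) * u s =
              L `^ p * s * (u s * s `^ (p - 1)) by ring.
    have -> : L `^ p * C * s = L `^ p * s * C by ring.
    by rewrite ler_wpM2l ?uC// mulr_ge0 ?powR_ge0 ?ltW.
  - exact: cvg_cst.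
  - rewrite -[X in _ --> X](mulr0 (L `^ p * C)); apply: cvgMr.
    by apply: cvg_at_right_filter; exact: cvg_id.
have G0 : G 0 = 0 by rewrite /G H0 w0 mul0r subrr mulr0.
have GD : G D = 0 by rewrite /G /H dwD spow0 uD !mulr0 subrr mulr0.
have eG : continuous (fun s : R => expR (c * s)).
  move=> s; apply: (@continuous_comp _ _ _ ( *%R c) expR).
    exact: mulrl_continuous.
  exact: continuous_expR.
have cG : {within `[0, D], continuous G}.
  apply/(continuous_within_itvP _ D0); split.
  - move=> t /dGP[Gt _]; exact/differentiable_continuous/derivable1_diffP.
  - apply: cvgM; first by apply: cvg_at_right_filter; exact: eG.
    by apply: cvgB; [exact: cvgM|rewrite H0].
  - apply: cvgM; first by apply: cvg_at_left_filter; exact: eG.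
    apply: cvgB; first exact: cvgM.
    apply: cvgM; last by rewrite uD.
    exact: (cvg_comp _ _ wDl (cnp (w D))).
have Gmono : forall x y, 0 <= x -> x <= y -> y <= D -> G x <= G y.
  apply: ger0_derive1_ndecr cG => [x /dGP[]//|x xD].
  by rewrite derive1E; have [_ ->] := dGP x xD; exact: dG_ge0.
(* [G] is nondecreasing and vanishes at both ends, hence vanishes throughout. Its derivative is then
   0, and the lower bound [dG0] with lam < Lam forces w = 0. *)
have Gz t : t \in `]0, D[ -> G t = 0.
  move=> tD; apply/eqP; rewrite eq_le -[X in _ <= X]GD -[X in _ && (X <= _)]G0.
  by rewrite !Gmono ?lexx ?(itvP tD)// ltW ?(itvP tD).
have wz t : t \in `]0, D[ -> w t = 0.
  move=> tD.
  have h : is_derive t 1 (cst 0 : R -> R) (dG t).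
    apply: near_eq_is_derive (dGP t tD).
    near=> s; apply: Gz; near: s; exact: near_in_itvoo.
  have dGt : dG t = 0.
    by have [_ <-] := h; rewrite derive_cst.
  have := dG0 t tD; rewrite dGt mul0r pmulr_rle0 ?subr_gt0// => wp.
  have {wp} : `|w t| `^ p == 0 by rewrite eq_le wp powR_ge0.
  by rewrite powR_eq0 p0' andbT normr_eq0 => /eqP.
move=> t; rewrite in_itv /= !le_eqVlt => /andP[/predU1P[<-//|t0]].
move=> /predU1P[->|tD]; last by apply: wz; rewrite in_itv /= t0.
have wl0 : w s @[s --> D^'-] --> 0.
  apply: (@cvg_trans _ ((fun=> 0 : R) s @[s --> D^'-])); last exact: cvg_cst.
  apply: near_eq_cvg.
  by near=> s; rewrite wz// in_itv /=; apply/andP; split.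
exact: (cvg_unique _ wDl wl0).
Unshelve. all: by end_near. Qed.

(** * The profile of the first eigenfunction *)

(** Exponents at most 1 are included, where differentiability at 0 fails; continuity at 0 is
    therefore checked directly, with radius e^(1/a). *)
Lemma continuous_norm_powR (R : realType) (a : R) : 0 < a ->
  continuous (fun y : R => `|y| `^ a).
Proof.
move=> a0 x; have [->|x0] := eqVneq x 0.
  apply/cvgrPdist_lt => e e0; exists (e `^ a^-1); first by rewrite /= powR_gt0.
  move=> z /=; rewrite sub0r normrN => zd.
  rewrite normr0 powR0 ?gt_eqF// sub0r normrN ger0_norm ?powR_ge0//.
  have -> : e = (e `^ a^-1) `^ a.
    by rewrite -powRrM mulVf ?powRr1 ?(ltW e0)// gt_eqF.
  by apply: gt0_ltr_powR; rewrite ?nnegrE ?powR_ge0.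
apply: (@continuous_comp _ _ _ (fun y : R => `|y|) (@powR R ^~ a)).
  exact: norm_continuous.
apply/differentiable_continuous/derivable1_diffP.
by have [] := @is_derive1_powR R a `|x| (etrans (normr_gt0 x) x0).
Qed.

(** * Closure properties of continuity relative to a set *)

Section within_continuous.
Variables (R : realType) (A : set R).
Implicit Types f g : R -> R.

Let cvgP f : {within A, continuous f} <->
  forall t, A t -> f s @[s --> within A (nbhs t)] --> f t.
Proof. exact: subspace_continuousP. Qed.

Lemma within_continuousD f g :
  {within A, continuous f} -> {within A, continuous g} ->
  {within A, continuous (fun x => f x + g x)}.
Proof. by move=> cf cg x; apply: cvgD; [exact: cf|exact: cg]. Qed.

Lemma within_continuousB f g :
  {within A, continuous f} -> {within A, continuous g} ->
  {within A, continuous (fun x => f x - g x)}.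
Proof. by move=> cf cg x; apply: cvgB; [exact: cf|exact: cg]. Qed.

Lemma within_continuousM f g :
  {within A, continuous f} -> {within A, continuous g} ->
  {within A, continuous (fun x => f x * g x)}.
Proof. by move=> cf cg x; apply: cvgM; [exact: cf|exact: cg]. Qed.

Lemma within_continuousV f : (forall t, A t -> f t != 0) ->
  {within A, continuous f} -> {within A, continuous (fun x => (f x)^-1)}.
Proof. by move=> f0 /cvgP cf; apply/cvgP => t At; apply: cvgV; auto. Qed.

Lemma within_continuous_comp f g :
  {within A, continuous f} -> continuous g ->
  {within A, continuous (fun x => g (f x))}.
Proof.
move=> /cvgP cf cg; apply/cvgP => t At.
exact: (cvg_comp _ _ (cf t At) (cg (f t))).
Qed.

Lemma eq_within_continuous f g : (forall t, A t -> f t = g t) ->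
  {within A, continuous f} -> {within A, continuous g}.
Proof.
move=> fg /within_continuous_epsdelta cf; apply/within_continuous_epsdelta.
move=> t At e e0; have [d d0 hd] := cf t At e e0.
by exists d => // s As sd; rewrite -!fg//; exact: hd.
Qed.

Lemma within_continuous_powR f a : 0 < a -> (forall t, A t -> 0 <= f t) ->
  {within A, continuous f} -> {within A, continuous (fun x => f x `^ a)}.
Proof.
move=> a0 f0 cf.
apply: (@eq_within_continuous (fun x => `|f x| `^ a)) => [t At|].
  by rewrite ger0_norm// f0.
exact: within_continuous_comp cf (continuous_norm_powR a0).
Qed.

Lemma within_continuous_id : {within A, continuous (fun x : R => x)}.
Proof. by apply: continuous_subspaceT => x; exact: cvg_id. Qed.

Lemma within_continuous_cst (a : R) : {within A, continuous (fun=> a)}.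
Proof. by apply: continuous_subspaceT => x; exact: cvg_cst. Qed.

Lemma within_continuous_onem : {within A, continuous (fun x : R => 1 - x)}.
Proof.
apply: within_continuousB; first exact: within_continuous_cst.
exact: within_continuous_id.
Qed.

Lemma within_continuous_compS (B : set R) f g :
  {within A, continuous f} -> {within B, continuous g} ->
  (forall t, A t -> B (f t)) -> {within A, continuous (fun x => g (f x))}.
Proof.
move=> /within_continuous_epsdelta cf /within_continuous_epsdelta cg fAB.
apply/within_continuous_epsdelta => t At e e0.
have [d1 d10 h1] := cg (f t) (fAB t At) e e0.
have [d d0 h] := cf t At d1 d10.
by exists d => // s As sd; apply: h1; [exact: fAB|exact: h].
Qed.

End within_continuous.

(** * The functions in the compactified Riccati equation *)

Section profile.
Variables (R : realType) (p : R).
Hypothesis p1 : 1 < p.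
Implicit Types b s : R.

Local Notation q := (p / (p - 1)).

Let pm0 : 0 < p - 1. Proof. by rewrite subr_gt0. Qed.
Let p0 : 0 < p. Proof. exact: lt_trans p1. Qed.
Let q0 : 0 < q. Proof. by rewrite divr_gt0. Qed.

(* In the parameter s, the Riccati equation for eps^(-p) and b = c eps becomes
   s' = profN b s / (eps * profM s). *)
Definition profN b s := s `^ p + b * s * (1 - s) + (p - 1) * (1 - s) `^ q.

(** For s > 0 the derivative of (1 - s) / s^(p-1) is - [profM s] / s^p. *)
Definition profM s := (p - 1) * (1 - s) + s.

(** For s >= 1/2 the term s^p alone gives the bound, and for s <= 1/2 the term (p-1) (1-s)^q does.
    The bound is uniform in [b], which makes later constants independent of D. *)
Lemma profN_bound : exists2 k : R, 0 < k &
  forall b s, 0 <= b -> s \in `[0, 1] -> k <= profN b s.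
Proof.
have h0 : 0 < (2^-1 : R) by rewrite invr_gt0.
exists (Num.min (2^-1 `^ p) ((p - 1) * 2^-1 `^ q)).
  by rewrite lt_min powR_gt0// mulr_gt0// powR_gt0.
move=> b s b0; rewrite in_itv /= => /andP[s0 s1].
have x0 : 0 <= 1 - s by rewrite subr_ge0.
rewrite ge_min /profN; have [sh|/ltW sh] := leP 2^-1 s.
  rewrite -addrA ler_wpDr ?addr_ge0 ?mulr_ge0 ?powR_ge0 ?(ltW pm0)//.
  by apply: ge0_ler_powR; rewrite ?nnegrE// ltW.
rewrite orbC ler_wpDl ?addr_ge0 ?mulr_ge0 ?powR_ge0 ?(ltW pm0)//.
rewrite ler_pM2l//; apply: ge0_ler_powR; rewrite ?nnegrE ?(ltW q0) ?(ltW h0)//.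
by lra.
Qed.

Lemma profN_gt0 b s : 0 <= b -> s \in `[0, 1] -> 0 < profN b s.
Proof.
move=> b0 s01; have [k k0 h] := profN_bound.
exact: lt_le_trans (h _ _ b0 s01).
Qed.

Lemma profM_gt0 s : s \in `[0, 1] -> 0 < profM s.
Proof.
rewrite in_itv /= /profM => /andP[s0 s1].
have [->|sn0] := eqVneq s 0; first by rewrite subr0 mulr1 addr0.
apply: ltr_wpDl; last by rewrite lt_def sn0.
by rewrite mulr_ge0 ?(ltW pm0)// subr_ge0.
Qed.

Lemma profM_le s : s \in `[0, 1] -> profM s <= p.
Proof.
rewrite in_itv /= /profM => /andP[s0 s1].
have := mulr_ge0 (ltW pm0) s0; lra.
Qed.

Lemma within_profN b : {within `[0, 1], continuous (profN b)}.
Proof.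
have x0 (t : R) : [set` `[0, 1]] t -> 0 <= 1 - t.
  by rewrite /= in_itv /= subr_ge0 => /andP[].
have cid : {within `[0, 1], continuous (fun s : R => s)}.
  exact: within_continuous_id.
have ccst (a : R) : {within `[0, 1], continuous (fun _ : R => a)}.
  exact: within_continuous_cst.
apply: within_continuousD; first apply: within_continuousD.
- by apply: within_continuous_powR => // t; rewrite /= in_itv /= => /andP[].
- apply: within_continuousM; last exact: within_continuous_onem.
  exact: within_continuousM.
- apply: within_continuousM => //.
  apply: within_continuous_powR => //; exact: within_continuous_onem.
Qed.

Lemma within_profM : {within `[0, 1], continuous profM}.
Proof.
apply: within_continuousD; last exact: within_continuous_id.
apply: within_continuousM; first exact: within_continuous_cst.
exact: within_continuous_onem.
Qed.

Lemma within_profMN b : 0 <= b ->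
  {within `[0, 1], continuous (fun s => profM s / profN b s)}.
Proof.
move=> b0; apply: within_continuousM; first exact: within_profM.
apply: within_continuousV; last exact: within_profN.
by move=> t t01; rewrite gt_eqF// profN_gt0.
Qed.

(* The factor rho of the solution w = eps s rho satisfies
   d (ln rho) / ds = profK b s / profN b s. *)
Definition profK b s := (1 - s) `^ (q - 1) - s `^ (p - 1) - b * (1 - s).

Lemma within_profKN b : 0 <= b ->
  {within `[0, 1], continuous (fun s => profK b s / profN b s)}.
Proof.
move=> b0; apply: within_continuousM; last first.
  apply: within_continuousV; last exact: within_profN.
  by move=> t t01; rewrite gt_eqF// profN_gt0.
have x0 (t : R) : [set` `[0, 1]] t -> 0 <= 1 - t.
  by rewrite /= in_itv /= subr_ge0 => /andP[].
have qm0 : 0 < q - 1.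
  by rewrite (_ : q - 1 = (p - 1)^-1) ?invr_gt0//; field; rewrite gt_eqF.
apply: within_continuousB; first apply: within_continuousB.
- apply: within_continuous_powR => //; exact: within_continuous_onem.
- apply: within_continuous_powR => //.
    by move=> t; rewrite /= in_itv /= => /andP[].
  exact: within_continuous_id.
- apply: within_continuousM; last exact: within_continuous_onem.
  exact: within_continuous_cst.
Qed.

End profile.

(** * The least positive eigenvalue *)

Section time_map.
Variables (R : realType) (p c eps : R).
Hypotheses (p1 : 1 < p) (c0 : 0 <= c) (eps0 : 0 < eps).

Local Notation q := (p / (p - 1)).
Local Notation b := (c * eps).

Let pm0 : 0 < p - 1. Proof. by rewrite subr_gt0. Qed.
Let p0 : 0 < p. Proof. exact: lt_trans p1. Qed.
Let b0 : 0 <= b. Proof. by rewrite mulr_ge0// ltW. Qed.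
Let epsn0 : eps != 0. Proof. by rewrite gt_eqF. Qed.

(** The time at which the profile parameter reaches [s] is eps times this value; at s = 1 it is
    D. *)
Definition profT (s : R) := primitive (fun s => profM p s / profN p b s) s.

Lemma profT_continuous : {within `[0, 1], continuous profT}.
Proof. by apply: primitive_continuous => //; exact: within_profMN. Qed.

Lemma is_derive_profT (s : R) : s \in `]0, 1[ ->
  is_derive s 1 profT (profM p s / profN p b s).
Proof. by apply: is_derive_primitive => //; exact: within_profMN. Qed.

(** Separation of variables: the integrand is positive, so the time map is increasing, and its
    inverse [S] solves the autonomous equation for s. *)
Lemma time_map : exists S : R -> R,
  [/\ forall t, S t \in `[0, 1],
      S 0 = 0 /\ S (eps * profT 1) = 1,
      {within `[0, eps * profT 1], continuous S},
      forall t : R, t \in `[0, eps * profT 1] -> eps * profT (S t) = t &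
      forall t : R, t \in `]0, eps * profT 1[ -> (S t \in `]0, 1[) /\
        is_derive t 1 S (profN p b (S t) / (eps * profM p (S t)))].
Proof.
have T0 : eps * profT 0 = 0 by rewrite /profT primitive0 mulr0.
have cT : {within `[0, 1], continuous (fun s => eps * profT s)}.
  apply: within_continuousM; first exact: within_continuous_cst.
  exact: profT_continuous.
pose g s := eps * (profM p s / profN p b s).
have dT (s : R) : s \in `]0, 1[ -> is_derive s 1 (fun s => eps * profT s) (g s).
  by move=> s01; have := is_deriveZ eps (is_derive_profT s01).
have g0 (s : R) : s \in `]0, 1[ -> 0 < g s.
  move=> /subset_itv_oo_cc s01.
  by rewrite mulr_gt0// divr_gt0 ?profM_gt0// profN_gt0.
have [S [S01 [TS ST] cS dS]] := inverse_segment ltr01 cT dT g0.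
exists S; rewrite T0 in TS cS dS; split => //.
  split; last by apply: ST; rewrite in_itv /= ler01 lexx.
  by have := ST 0; rewrite T0; apply; rewrite in_itv /= lexx ler01.
move=> t tD; have [Soo dSt] := dS t tD; split => //.
apply: is_derive_eq; rewrite /g.
have /subset_itv_oo_cc S01' := Soo.
by field; rewrite epsn0 !gt_eqF ?profM_gt0 ?profN_gt0.
Qed.

End time_map.

Section least_eigenvalue.
Variables (R : realType) (p : R) (n : nat) (K : R).
Hypotheses (p1 : 1 < p) (n1 : (1 < n)%N).

Local Notation q := (p / (p - 1)).
Let c : R := (n%:R - 1) * Num.sqrt (- K).

Let pm0 : 0 < p - 1. Proof. by rewrite subr_gt0. Qed.
Let p0 : 0 < p. Proof. exact: lt_trans p1. Qed.
Let c0 : 0 <= c.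
Proof. by rewrite mulr_ge0 ?sqrtr_ge0// subr_ge0 ler1n ltnW. Qed.

Variable eps : R.
Hypothesis eps0 : 0 < eps.

Local Notation b := (c * eps).
Local Notation D := (eps * profT p c eps 1).

Let b0 : 0 <= b. Proof. by rewrite mulr_ge0// ltW. Qed.
Let epsn0 : eps != 0. Proof. by rewrite gt_eqF. Qed.
Let qm : q - 1 = (p - 1)^-1. Proof. by field; rewrite gt_eqF. Qed.
Let qm0 : 0 < q - 1. Proof. by rewrite qm invr_gt0. Qed.
Let q0 : 0 < q. Proof. by rewrite divr_gt0. Qed.

Let powS (s : R) : 0 <= s -> s `^ p = s * s `^ (p - 1).
Proof. by move=> s0; rewrite mulr_powRB1. Qed.

Let powX (x : R) : 0 <= x -> x `^ q = x * x `^ (q - 1).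
Proof. by move=> x0; rewrite mulr_powRB1. Qed.

Let N_gt0 (s : R) : s \in `[0, 1] -> 0 < profN p b s.
Proof. exact: profN_gt0. Qed.

Lemma profT1_gt0 : 0 < profT p c eps 1.
Proof.
have [s s01] := MVT_subitv (profT_continuous p1 c0 eps0)
  (is_derive_profT p1 c0 eps0) (lexx 0) ler01 (lexx 1).
rewrite {2}/profT primitive0 !subr0 mulr1 => ->.
by rewrite divr_gt0 ?profM_gt0 ?N_gt0.
Qed.

Let D0 : 0 < D. Proof. by rewrite mulr_gt0// profT1_gt0. Qed.

(** The solution is written down explicitly along [S]. With [P] a primitive of the logarithmic
    derivative of rho, w = eps S exp(P(S)); the boundary conditions hold because S is 0 at time 0
    and 1 at time D. *)
Lemma eigenfunction_exists : exists w, eigenfunction p n K D (eps `^ (- p)) w.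
Proof.
have [S [S01 [S0 S1] cS _ dS]] := time_map p1 c0 eps0.
pose P := primitive (fun s => profK p b s / profN p b s).
have cP : {within `[0, 1], continuous P}.
  by apply: primitive_continuous => //; exact: within_profKN.
have dP (s : R) : s \in `]0, 1[ -> is_derive s 1 P (profK p b s / profN p b s).
  by apply: is_derive_primitive => //; exact: within_profKN.
have cPS : {within `[0, D], continuous (fun t => P (S t))}.
  by apply: within_continuous_compS cS cP _ => t _; exact: S01.
have cE a : {within `[0, D], continuous (fun t => expR (a * P (S t)))}.
  apply: within_continuous_comp; last exact: continuous_expR.
  by apply: within_continuousM => //; exact: within_continuous_cst.
have S_ge0 t : 0 <= S t by have := S01 t; rewrite in_itv /= => /andP[].
have X_ge0 t : 0 <= 1 - S t.
  by have := S01 t; rewrite in_itv /= subr_ge0 => /andP[].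
have cX : {within `[0, D], continuous (fun t => 1 - S t)}.
  by apply: within_continuousB => //; exact: within_continuous_cst.
(* The factor 1 in the exponent puts [w] and [dw] in the form exp(a P(S)) with a = 1, so that [cE]
   and [dES] cover them together with a = p - 1. *)
pose w t := eps * S t * expR (1 * P (S t)).
pose dw t := (1 - S t) `^ (q - 1) * expR (1 * P (S t)).
pose dv t := - eps^-1 * expR ((p - 1) * P (S t)) *
  (S t `^ (p - 1) + b * (1 - S t)).
(* Since (q - 1) (p - 1) = 1, the power turns (1 - S)^(q-1) into 1 - S. *)
have vE t : spow p (dw t) = (1 - S t) * expR ((p - 1) * P (S t)).
  rewrite ge0_spow// ?mulr_ge0 ?powR_ge0 ?expR_ge0//.
  rewrite powRM ?powR_ge0 ?expR_ge0// -powRrM qm mulVf ?gt_eqF// powRr1//.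
  by rewrite -expRM mul1r [P _ * _]mulrC.
have wE t : spow p (w t) =
    eps `^ (p - 1) * S t `^ (p - 1) * expR ((p - 1) * P (S t)).
  rewrite ge0_spow// ?mulr_ge0 ?expR_ge0 ?(ltW eps0)//.
  rewrite !powRM ?mulr_ge0 ?expR_ge0 ?(ltW eps0)//.
  by rewrite -expRM mul1r [P _ * _]mulrC.
have dES a t : t \in `]0, D[ -> is_derive t 1 (fun t => expR (a * P (S t)))
    (expR (a * P (S t)) * (a * (profK p b (S t) / (eps * profM p (S t))))).
  move=> tD; have [Soo dSt] := dS t tD.
  apply: (@is_derive1_comp _ expR (fun t => a * P (S t))).
  have h := is_deriveZ a (is_derive1_comp (dP _ Soo) dSt).
  apply: is_derive_eq h _; have /subset_itv_oo_cc S01' := Soo.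
  rewrite /GRing.scale /=.
  by field; rewrite epsn0 !gt_eqF ?profM_gt0 ?N_gt0.
have wC1 : C1_on `[0, D] w dw.
  have h1 : {within `[0, D], continuous w}.
    apply: within_continuousM => //; apply: within_continuousM => //.
    exact: within_continuous_cst.
  have h2 : {within `[0, D], continuous dw}.
    apply: within_continuousM => //; exact: within_continuous_powR.
  have h3 (t : R) : t \in `]0, D[ -> is_derive t 1 w (dw t).
    move=> tD; have [Soo dSt] := dS t tD.
    have h := is_deriveM (is_deriveZ eps dSt) (dES 1 t tD).
    apply: is_derive_eq h _; have /subset_itv_oo_cc S01' := Soo.
    have M0 := profM_gt0 p1 S01'.
    rewrite /GRing.scale /= ?fctE /GRing.scale /= /dw /profN /profK.
    (* After s^p and (1-s)^q are split, only the powers p - 1 and q - 1 remain. Treated as atoms,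
       they reduce the claim to an identity of rational functions. *)
    rewrite (powS (S_ge0 t)) (powX (X_ge0 t)).
    move: M0; rewrite /profM.
    move: ((1 - S t) `^ _) (S t `^ _) (expR _) => xq sp E M0.
    by field; rewrite epsn0 gt_eqF.
  exact: C1_on_itv h1 h2 h3.
have vC1 : C1_on `[0, D] (fun t => spow p (dw t)) dv.
  rewrite (_ : (fun t => _) = fun t => (1 - S t) * expR ((p - 1) * P (S t))).
    2: by apply/funext => t; exact: vE.
  have h1 : {within `[0, D], continuous
      (fun t => (1 - S t) * expR ((p - 1) * P (S t)))}.
    exact: within_continuousM.
  have h2 : {within `[0, D], continuous dv}.
    apply: within_continuousM.
      apply: within_continuousM => //; exact: within_continuous_cst.
    apply: within_continuousD; first exact: within_continuous_powR.
    apply: within_continuousM => //; exact: within_continuous_cst.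
  have h3 (t : R) : t \in `]0, D[ ->
      is_derive t 1 (fun t => (1 - S t) * expR ((p - 1) * P (S t))) (dv t).
    move=> tD; have [Soo dSt] := dS t tD.
    have h := is_deriveM (is_deriveB (is_derive_cst (1 : R) t 1) dSt)
                         (dES (p - 1) t tD).
    apply: is_derive_eq h _; have /subset_itv_oo_cc S01' := Soo.
    have M0 := profM_gt0 p1 S01'; have N0 := N_gt0 S01'.
    rewrite /GRing.scale /= ?fctE /GRing.scale /= /dv /profK; move: N0 M0.
    rewrite /profN /profM (powS (S_ge0 t)) (powX (X_ge0 t)).
    move: ((1 - S t) `^ _) (S t `^ _) (expR _) => xq sp E N0 M0.
    by field; rewrite epsn0 gt_eqF.
  exact: C1_on_itv h1 h2 h3.
exists w, dw, dv; split => //.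
- move=> t _; rewrite vE wE /dv -/c.
  have -> : eps `^ (- p) = eps^-1 / eps `^ (p - 1).
    rewrite -powR_inv1 ?(ltW eps0)// -powRN -powRD ?epsn0 ?implybT//.
    by congr (_ `^ _); ring.
  have : 0 < eps `^ (p - 1) by exact: powR_gt0.
  move: (eps `^ _) (S t `^ _) (expR _) => ep sp E ep0.
  by field; rewrite epsn0 gt_eqF.
- rewrite /w /dw S0 S1 mulr0 mul0r subrr powR0 ?mul0r// gt_eqF//.
- exists D; first by rewrite in_itv /= lexx ltW.
  by rewrite /w S1 mulr1 mulf_neq0// gt_eqF// expR_gt0.
Qed.

(** If lam < eps^(-p), Picone's identity with Lam = eps^(-p) and the Riccati solution [u] built from
    [S] would force w = 0. *)
Lemma eigenvalue_ge lam w : eigenfunction p n K D lam w -> eps `^ (- p) <= lam.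
Proof.
move=> [dw [dv [wC1 vC1 eqn [w0 dwD] [t1 t1D wt1]]]].
rewrite leNgt; apply/negP => lamlt; move/negP: wt1; apply; apply/eqP.
have [S [S01 [S0 S1] cS TS dS]] := time_map p1 c0 eps0.
pose u t := eps `^ (1 - p) * ((1 - S t) / S t `^ (p - 1)).
have [k k0 kN] := profN_bound p1.
(* The integrand of [profT] is at most p/k, so t <= eps (p/k) S(t). Together with 1 - S <= 1 this
   bounds u t^(p-1). *)
pose C := eps `^ (1 - p) * (eps * (p / k)) `^ (p - 1).
have eqe : eps `^ (1 - p) = eps * eps `^ (- p).
  by rewrite -[X in X * _]powRr1 ?ltW// -powRD ?epsn0 ?implybT.
have dU (s : R) : 0 < s -> is_derive s 1 (fun s => (1 - s) / s `^ (p - 1))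
    (- (s `^ (p - 1))^-1 - (1 - s) * ((p - 1) / s `^ p)).
  move=> s0.
  have sp0 : 0 < s `^ (p - 1) by exact: powR_gt0.
  have h1 : is_derive s 1 (fun y : R => 1 - y) (0 - 1).
    exact: is_deriveB (is_derive_cst (1 : R) s 1) (is_derive_id s 1).
  have h2 : is_derive s 1 (fun y : R => y `^ (p - 1))
      ((p - 1) * s `^ (p - 1 - 1)) by exact: is_derive1_powR.
  have h3 := is_deriveM h1 
    (@is_deriveV R (fun y => y `^ (p - 1)) s _ 1 (lt0r_neq0 sp0) h2).
  apply: is_derive_eq h3 _; rewrite /GRing.scale /= ?fctE /GRing.scale /=.
  have -> : s `^ (p - 1 - 1) = s `^ (p - 1) / s.
    by rewrite powRB ?(gt_eqF s0) ?implybT// powRr1// ltW.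
  rewrite (powS (ltW s0)).
  by field; rewrite !gt_eqF.
have u0 (t : R) : t \in `]0, D[ -> 0 <= u t.
  move=> _; rewrite /u mulr_ge0 ?powR_ge0// divr_ge0 ?powR_ge0//.
  by have := S01 t; rewrite in_itv /= subr_ge0 => /andP[].
have du (t : R) : t \in `]0, D[ -> is_derive t 1 u
    (- (eps `^ (- p) + c * u t + (p - 1) * u t `^ q)).
  move=> tD; have [Soo dSt] := dS t tD.
  have /subset_itv_oo_cc S01' := Soo.
  have St0 : 0 < S t by rewrite (itvP Soo).
  have Xt0 : 0 <= 1 - S t by rewrite subr_ge0 (itvP S01').
  have h := is_deriveZ (eps `^ (1 - p)) (is_derive1_comp (dU _ St0) dSt).
  apply: is_derive_eq h _; rewrite /GRing.scale /= /u.
  have -> : (eps `^ (1 - p) * ((1 - S t) / S t `^ (p - 1))) `^ q =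
      eps `^ (- p) * ((1 - S t) `^ q / S t `^ p).
    have e1 : (1 - p) * q = - p by field; rewrite gt_eqF.
    have e2 : - (p - 1) * q = - p by field; rewrite gt_eqF.
    rewrite -!powRN !powRM ?powR_ge0 ?mulr_ge0 ?powR_ge0//.
    by rewrite -!powRrM e1 e2.
  have M0 := profM_gt0 p1 S01'.
  rewrite eqe /profN (powS (ltW St0)) (powX Xt0).
  move: M0; rewrite /profM.
  have : 0 < S t `^ (p - 1) by exact: powR_gt0.
  move: (eps `^ _) ((1 - S t) `^ _) (S t `^ _) => ep xq sp sp0 M0.
  by field; rewrite epsn0 !gt_eqF.
have uD : u D = 0 by rewrite /u S1 subrr mul0r mulr0.
have uDl : u s @[s --> D^'-] --> 0.
  have Sl : S s @[s --> D^'-] --> (1 : R).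
    by have /(continuous_within_itvP _ D0)[_ _] := cS; rewrite S1.
  have -> : 0 = eps `^ (1 - p) * ((1 - 1) / 1 `^ (p - 1)) :> R.
    by rewrite subrr mul0r mulr0.
  have h : {for (1 : R), continuous (fun s : R => (1 - s) / s `^ (p - 1))}.
    apply/differentiable_continuous/derivable1_diffP.
    by have [] := dU 1 ltr01.
  by apply: cvgMr; exact: (cvg_comp _ _ Sl h).
have uC (t : R) : t \in `]0, D[ -> u t * t `^ (p - 1) <= C.
  move=> tD; have [Soo _] := dS t tD.
  have S0t : 0 < S t by rewrite (itvP Soo).
  have St1 : S t < 1 by rewrite (itvP Soo).
  have tTS : eps * profT p c eps (S t) = t by apply/TS/subset_itv_oo_cc.
  have TSle : profT p c eps (S t) <= p / k * S t.
    have T0 : profT p c eps 0 = 0 by rewrite /profT primitive0.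
    have sub s : s \in `]0, S t[ -> s \in `]0, 1[.
      by apply: subset_itvl; rewrite bnd_simp ltW.
    have h1 : {within `[0, S t], continuous (profT p c eps)}.
      apply: continuous_subspaceW (profT_continuous p1 c0 eps0).
      by apply: subset_itvl; rewrite bnd_simp ltW.
    have h2 : {within `[0, S t], continuous (fun s => p / k * s)}.
      apply: within_continuousM; first exact: within_continuous_cst.
      exact: within_continuous_id.
    have h3 (s : R) : s \in `]0, S t[ ->
        is_derive s 1 (profT p c eps) (profM p s / profN p b s).
      by move/sub; exact: is_derive_profT.
    have h4 (s : R) : s \in `]0, S t[ ->
        is_derive s 1 (fun s => p / k * s) (p / k).
      move=> _; have h := is_deriveZ (p / k) (is_derive_id s (1 : R)).
      by apply: is_derive_eq h _; rewrite [LHS]mulr1.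
    have h5 (s : R) : s \in `]0, S t[ -> profM p s / profN p b s <= p / k.
      move/sub/subset_itv_oo_cc => s01.
      rewrite ler_pM ?invr_ge0 ?profM_le ?(ltW (N_gt0 s01))
        ?(ltW (profM_gt0 p1 s01))//.
      by rewrite lef_pV2 ?posrE ?N_gt0// kN.
    by have := ler_increment (ltW S0t) h1 h2 h3 h4 h5; rewrite T0 mulr0 !subr0.
  rewrite /u /C -mulrA ler_wpM2l ?powR_ge0//.
  have t0 : 0 < t by rewrite (itvP tD).
  have tle : t `^ (p - 1) <= (eps * (p / k)) `^ (p - 1) * S t `^ (p - 1).
    rewrite -powRM ?(ltW S0t)//; last by rewrite mulr_ge0 ?divr_ge0 ?ltW.
    apply: ge0_ler_powR; rewrite ?nnegrE ?(ltW pm0) ?(ltW t0)//.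
      by rewrite !mulr_ge0 ?invr_ge0 ?ltW.
    by rewrite -{1}tTS -mulrA ler_pM2l.
  rewrite mulrAC ler_pdivrMr ?powR_gt0//; apply: le_trans tle.
  by rewrite ler_piMl ?powR_ge0// gerBl ltW.
exact: (picone_eq0 p1 D0 lamlt wC1 vC1 eqn w0 dwD u0 du uD uDl uC).
Qed.

Lemma lambda_barE : lambda_bar p n K D = eps `^ (- p).
Proof.
have mem : pos_eigenvalues p n K D (eps `^ (- p)).
  by split; [exact: powR_gt0|exact: eigenfunction_exists].
have lb : lbound (pos_eigenvalues p n K D) (eps `^ (- p)).
  by move=> lam [_ [w /eigenvalue_ge]].
rewrite /lambda_bar.
(* A least element is unique by antisymmetry; the default branch is impossible because eps^(-p) is
   one. *)
case: xgetP => [l _ [l1 l2]|/(_ (eps `^ (- p)))/not_andP[]//].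
by apply/eqP; rewrite eq_le l2//= lb.
Qed.

End least_eigenvalue.

(** * Asymptotics of J *)

(** Young's inequality for the product s * 1 with exponent a, multiplied by a. *)
Lemma bernoulli_powR (R : realType) (a s : R) : 1 < a -> 0 <= s ->
  1 + a * (s - 1) <= s `^ a.
Proof.
move=> a1 s0; have am0 : 0 < a - 1 by rewrite subr_gt0.
have a0 : 0 < a by exact: lt_trans a1.
have e : a^-1 + (a / (a - 1))^-1 = 1 by field; rewrite !gt_eqF.
have := conjugate_powR s0 (ler01 : 0 <= 1 :> R) a0 (divr_gt0 a0 am0) e.
rewrite mulr1 powR1 -(ler_pM2l a0) mulrDr [a * (_ / a)]mulrC divfK ?gt_eqF//.
have -> : a * (1 / (a / (a - 1))) = a - 1 by field; rewrite !gt_eqF.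
by lra.
Qed.

Lemma powR_le_id (R : realType) (a s : R) :
  1 < a -> s \in `[0, 1] -> s `^ a <= s.
Proof.
move=> a1; rewrite in_itv /= le_eqVlt => /andP[/predU1P[<-|s0] s1].
  by rewrite powR0// gt_eqF// (lt_trans _ a1).
by apply: ge1r_powR; rewrite ?s0// ltW.
Qed.

Section profJ.
Variables (R : realType) (p : R).
Hypothesis p1 : 1 < p.
Implicit Types b s : R.

Local Notation q := (p / (p - 1)).

Let pm0 : 0 < p - 1. Proof. by rewrite subr_gt0. Qed.
Let p0 : 0 < p. Proof. exact: lt_trans p1. Qed.
Let q1 : 1 < q. Proof. by rewrite ltr_pdivlMr// mul1r gtrBl. Qed.

Definition profJ b := primitive (fun s => profM p s / profN p b s) 1.

(** The primitive of the scaled integrand is compared with f + C s and f - C s on [0, 1]. For [f]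
    one takes another primitive of the same family, or an explicit antiderivative. *)
Lemma profJ_cmp b (f df : R -> R) (a C : R) : 0 <= b ->
  {within `[0, 1], continuous f} ->
  (forall s, s \in `]0, 1[ -> is_derive s 1 f (df s)) ->
  (forall s, s \in `]0, 1[ -> `|a * (profM p s / profN p b s) - df s| <= C) ->
  `|a * profJ b - (f 1 - f 0)| <= C.
Proof.
move=> b0 cf fdf le.
set T := primitive (fun s => profM p s / profN p b s).
have cT : {within `[0, 1], continuous T}.
  by apply: primitive_continuous => //; exact: within_profMN.
have dT (s : R) : s \in `]0, 1[ -> is_derive s 1 T (profM p s / profN p b s).
  by apply: is_derive_primitive => //; exact: within_profMN.
have caT : {within `[0, 1], continuous (fun s => a * T s)}.
  apply: within_continuousM => //; exact: within_continuous_cst.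
have daT (s : R) : s \in `]0, 1[ -> is_derive s 1 (fun s => a * T s)
    (a * (profM p s / profN p b s)).
  by move=> s01; have := is_deriveZ a (dT s s01).
have cl (e : R) : {within `[0, 1], continuous (fun s => f s + e * s)}.
  apply: within_continuousD => //; apply: within_continuousM.
    exact: within_continuous_cst.
  exact: within_continuous_id.
have dl (e s : R) : s \in `]0, 1[ ->
    is_derive s 1 (fun s => f s + e * s) (df s + e).
  move=> s01.
  have h := is_deriveD (fdf s s01) (is_deriveZ e (is_derive_id s (1 : R))).
  by apply: is_derive_eq h _; rewrite /GRing.scale /= mulr1.
have T0 : T 0 = 0 by rewrite /T primitive0.
have -> : profJ b = T 1 by [].
have le1 s : s \in `]0, 1[ -> a * (profM p s / profN p b s) <= df s + C.
  by move=> /le; rewrite ler_norml => /andP[_]; rewrite lerBlDl.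
have le2 s : s \in `]0, 1[ -> df s + - C <= a * (profM p s / profN p b s).
  by move=> /le; rewrite ler_norml => /andP[]; rewrite lerBrDl.
have := ler_increment ler01 caT (cl C) daT (dl C) le1.
have := ler_increment ler01 (cl (- C)) caT (dl (- C)) daT le2.
rewrite T0 !mulr0 !mulr1 ler_norml => h1 h2.
by apply/andP; split; lra.
Qed.

(** [profN] is affine in b with slope s (1 - s), which lies in [0, 1]. The constant comes from
    [profM] <= p and the uniform bound [profN] >= k on both denominators. *)
Lemma profJ_lipschitz : exists2 C, 0 < C & forall b b', 0 <= b -> 0 <= b' ->
  `|profJ b - profJ b'| <= C * `|b - b'|.
Proof.
have [k k0 kN] := profN_bound p1.
exists (p / k ^+ 2); first by rewrite divr_gt0// exprn_gt0.
move=> b b' b0 b'0.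
have c' := within_profMN p1 b'0.
have cT : {within `[0, 1], continuous
    (primitive (fun s => profM p s / profN p b' s))}.
  exact: primitive_continuous.
have dT (s : R) : s \in `]0, 1[ -> is_derive s 1
    (primitive (fun s => profM p s / profN p b' s)) (profM p s / profN p b' s).
  exact: is_derive_primitive.
have := @profJ_cmp b _ _ 1 (p / k ^+ 2 * `|b - b'|) b0 cT dT.
rewrite mul1r primitive0 subr0 -/(profJ b'); apply => s /subset_itv_oo_cc s01.
have N0 := profN_gt0 p1 b0 s01; have N'0 := profN_gt0 p1 b'0 s01.
have M0 := profM_gt0 p1 s01.
rewrite mul1r.
have -> : profM p s / profN p b s - profM p s / profN p b' s =
    profM p s * (s * (1 - s)) / (profN p b s * profN p b' s) * (b' - b).
  move: N0 N'0; rewrite /profN.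
  move: (s `^ p) ((1 - s) `^ q) => sp xq N0 N'0.
  by field; rewrite !gt_eqF.
rewrite normrM [`|b' - b|]distrC ler_wpM2r//.
move: (s01); rewrite in_itv /= => /andP[s0 s1].
have x0 : 0 <= 1 - s by rewrite subr_ge0.
rewrite ger0_norm; last first.
  by rewrite divr_ge0// mulr_ge0 ?(ltW M0) ?(ltW N0) ?(ltW N'0)// mulr_ge0.
rewrite ler_pM ?invr_ge0 ?mulr_ge0 ?(ltW M0) ?(ltW N0) ?(ltW N'0)//.
  rewrite -[X in _ <= X]mulr1 ler_pM ?mulr_ge0 ?(ltW M0) ?profM_le//.
  by rewrite mulr_ile1// gerBl.
rewrite lef_pV2 ?posrE ?mulr_gt0// expr2.
by rewrite ler_pM ?(ltW k0) ?kN.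
Qed.

Lemma profJ_gt0 b : 0 <= b -> 0 < profJ b.
Proof.
move=> b0; have c := within_profMN p1 b0.
have cT : {within `[0, 1], continuous
    (primitive (fun s => profM p s / profN p b s))}.
  exact: primitive_continuous.
have dT (s : R) : s \in `]0, 1[ -> is_derive s 1
    (primitive (fun s => profM p s / profN p b s)) (profM p s / profN p b s).
  exact: is_derive_primitive.
have [s s01] := MVT_subitv cT dT (lexx 0) ler01 (lexx 1).
rewrite primitive0 !subr0 mulr1 -/(profJ b) => ->.
by rewrite divr_gt0 ?profM_gt0 ?profN_gt0.
Qed.

(** The integrand b M / (N0 + b s (1 - s)), where N0 does not involve b, is nondecreasing in b. As c
    D = b J(b) with b = c eps, this converts bounds on D into bounds on eps. *)
Lemma ler_mul_profJ b b' : 0 < b -> b <= b' -> b * profJ b <= b' * profJ b'.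
Proof.
move=> b0 bb'; have b'0 : 0 < b' by exact: lt_le_trans bb'.
have cT d : 0 < d -> {within `[0, 1], continuous
    (fun s => d * primitive (fun s => profM p s / profN p d s) s)}.
  move=> d0; apply: within_continuousM; first exact: within_continuous_cst.
  by apply: primitive_continuous => //; apply: within_profMN => //; exact: ltW.
have dT d s : 0 < d -> s \in `]0, 1[ -> is_derive s 1
    (fun s => d * primitive (fun s => profM p s / profN p d s) s)
    (d * (profM p s / profN p d s)).
  move=> d0 s01; have cd := within_profMN p1 (ltW d0).
  by have := is_deriveZ d (is_derive_primitive ltr01 cd s01).
have := ler_increment ler01 (cT _ b0) (cT _ b'0) (fun s => @dT b s b0)
  (fun s => @dT b' s b'0).
rewrite !primitive0 !mulr0 !subr0; apply => s /subset_itv_oo_cc s01.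
have N0 := profN_gt0 p1 (ltW b0) s01; have N'0 := profN_gt0 p1 (ltW b'0) s01.
have M0 := profM_gt0 p1 s01.
rewrite !mulrA ler_pdivrMr// mulrAC ler_pdivlMr//.
rewrite ![_ * profM p s]mulrC -!mulrA ler_pM2l// /profN -subr_ge0.
have -> : b' * (s `^ p + b * s * (1 - s) + (p - 1) * (1 - s) `^ q) -
    b * (s `^ p + b' * s * (1 - s) + (p - 1) * (1 - s) `^ q) =
    (b' - b) * (s `^ p + (p - 1) * (1 - s) `^ q) by ring.
by rewrite mulr_ge0 ?subr_ge0// addr_ge0 ?mulr_ge0 ?powR_ge0// ltW.
Qed.

(* As b -> oo the integrand of b J(b) concentrates at both ends of [0, 1]; it
   is within a bounded distance of
   (p - 1) b / (b s + p - 1) + b / (1 + b (1 - s)). *)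
Lemma mul_profJ_ln : exists C, forall b, 1 <= b ->
  `|b * profJ b - p * ln b| <= C.
Proof.
have [k k0 kN] := profN_bound p1.
(* The first summand bounds the difference of the integrands; the others bound the deviation of h(1)
   - h(0) from p ln b. *)
exists (2 * (p - 1) / k + (ln 2 + (p - 1) * ln p + `|(p - 1) * ln (p - 1)|)).
move=> b b1; have b0 : 0 < b by exact: lt_le_trans b1.
have A0 s : s \in `[0, 1] -> 0 < 1 + b * (1 - s).
  rewrite in_itv /= => /andP[_ s1].
  by rewrite ltr_pwDl// mulr_ge0 ?subr_ge0// ltW.
have B0 s : s \in `[0, 1] -> 0 < b * s + (p - 1).
  by rewrite in_itv /= => /andP[s0 _]; rewrite ltr_wpDl// mulr_ge0// ltW.
(* An antiderivative of the model integrand. *)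
pose h s := (p - 1) * ln (b * s + (p - 1)) - ln (1 + b * (1 - s)).
pose dh s := (p - 1) * (b / (b * s + (p - 1))) + b / (1 + b * (1 - s)).
have dhP s : s \in `[0, 1] -> is_derive s 1 h (dh s).
  move=> s01.
  have d1 : is_derive s 1 (fun s => b * s + (p - 1)) b.
    have e := is_deriveD (is_deriveZ b (is_derive_id s (1 : R)))
                         (is_derive_cst (p - 1) s 1).
    by apply: is_derive_eq e _; rewrite /GRing.scale /= mulr1 addr0.
  have d2 : is_derive s 1 (fun s => 1 + b * (1 - s)) (- b).
    have e := is_deriveD (is_derive_cst (1 : R) s 1) (is_deriveZ b
      (is_deriveB (is_derive_cst (1 : R) s 1) (is_derive_id s (1 : R)))).
    by apply: is_derive_eq e _; rewrite /GRing.scale /=; ring.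
  have e := is_deriveB
    (is_deriveZ (p - 1) (@is_derive1_comp _ _ (fun s => b * s + (p - 1)) s _ _
      (is_derive1_ln (B0 s s01)) d1))
    (@is_derive1_comp _ _ (fun s => 1 + b * (1 - s)) s _ _
      (is_derive1_ln (A0 s s01)) d2).
  apply: is_derive_eq e _; rewrite /GRing.scale /= /dh.
  by field; rewrite !gt_eqF ?A0 ?B0.
have ch : {within `[0, 1], continuous h}.
  apply/(continuous_within_itvP _ ltr01); split.
  - move=> s /subset_itv_oo_cc/dhP[d _].
    exact/differentiable_continuous/derivable1_diffP.
  - apply: cvg_at_right_filter.
    apply/differentiable_continuous/derivable1_diffP.
    by have [] := dhP 0 _; rewrite ?in_itv /= ?lexx ?ler01.
  - apply: cvg_at_left_filter; apply/differentiable_continuous/derivable1_diffP.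
    by have [] := dhP 1 _; rewrite ?in_itv /= ?lexx ?ler01.
have le s : s \in `]0, 1[ ->
    `|b * (profM p s / profN p b s) - dh s| <= 2 * (p - 1) / k.
  move=> /subset_itv_oo_cc s01.
  have N0 := profN_gt0 p1 (ltW b0) s01; have A := A0 s s01; have B := B0 s s01.
  move: (s01); rewrite in_itv /= => /andP[s0 s1].
  have x0 : 0 <= 1 - s by rewrite subr_ge0.
  have x01 : 1 - s \in `[0, 1] by rewrite in_itv /= x0 gerBl.
  (* These are the numerators left after subtracting the two model terms. As |r1| <= (p-1) (1-s) and
     |r2| <= s, by Bernoulli's inequality, the factor b is absorbed by the denominators 1 + b (1-s)
     and b s + p - 1. *)
  pose r1 := s - s `^ p - (p - 1) * (1 - s) `^ q.
  pose r2 := (p - 1) * (1 - s - (1 - s) `^ q) - s `^ p.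
  have -> : b * (profM p s / profN p b s) - dh s =
      b * r1 / (profN p b s * (1 + b * (1 - s))) +
      (p - 1) * (b * r2) / (profN p b s * (b * s + (p - 1))).
    rewrite /dh /r1 /r2; move: N0; rewrite /profM /profN.
    move: (s `^ p) ((1 - s) `^ q) => sp xq N0.
    by field; rewrite !gt_eqF.
  have le1 : `|r1| <= (p - 1) * (1 - s).
    have := bernoulli_powR p1 s0; have := powR_le_id p1 s01.
    have : (p - 1) * (1 - s) `^ q <= (p - 1) * (1 - s).
      by rewrite ler_pM2l// powR_le_id.
    have : 0 <= (p - 1) * (1 - s) `^ q by rewrite mulr_ge0 ?powR_ge0 ?ltW.
    rewrite /r1 ler_norml.
    move: (s `^ p) ((p - 1) * (1 - s) `^ q) => sp xq.
    by move=> *; apply/andP; split; lra.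
  have le2 : `|r2| <= s.
    have : (p - 1) * (1 + q * (1 - s - 1)) <= (p - 1) * (1 - s) `^ q.
      by rewrite ler_pM2l// bernoulli_powR.
    have -> : (p - 1) * (1 + q * (1 - s - 1)) = (p - 1) * (1 - s) - s.
      by field; rewrite gt_eqF.
    have : (p - 1) * (1 - s) `^ q <= (p - 1) * (1 - s).
      by rewrite ler_pM2l// powR_le_id.
    have := powR_le_id p1 s01; have := powR_ge0 s p.
    rewrite /r2 ler_norml [(p - 1) * (_ - _ `^ _)]mulrBr.
    move: (s `^ p) ((p - 1) * (1 - s) `^ q) => sp xq.
    by move=> *; apply/andP; split; lra.
  apply: le_trans (ler_normD _ _) _.
  have -> : 2 * (p - 1) / k = (p - 1) / k + (p - 1) / k by lra.
  have H (r B' : R) : 0 < B' -> `|r| <= (p - 1) * B' ->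
      `|r / (profN p b s * B')| <= (p - 1) / k.
    move=> B'0 rB; rewrite normrM normfV (gtr0_norm (mulr_gt0 N0 B'0)).
    rewrite ler_pdivrMr ?mulr_gt0//; apply: le_trans rB _.
    have -> : (p - 1) / k * (profN p b s * B') =
        (p - 1) * B' * (profN p b s / k) by field; rewrite gt_eqF.
    apply: ler_peMr; first by rewrite mulr_ge0 ?(ltW pm0) ?(ltW B'0).
    by rewrite ler_pdivlMr// mul1r kN// ltW.
  apply: lerD; apply: H => //.
    rewrite normrM (gtr0_norm b0).
    apply: (@le_trans _ _ (b * ((p - 1) * (1 - s)))).
      by rewrite ler_pM2l.
    by rewrite mulrCA ler_pM2l// lerDr.
  rewrite !normrM (gtr0_norm pm0) (gtr0_norm b0) ler_pM2l//.
  apply: (@le_trans _ _ (b * s)).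
    by rewrite ler_pM2l.
  by rewrite lerDl ltW.
have := profJ_cmp (ltW b0) ch (fun s s01 => dhP s (subset_itv_oo_cc s01)) le.
set y := b * profJ b => h1.
have -> : y - p * ln b = (y - (h 1 - h 0)) + (h 1 - h 0 - p * ln b) by ring.
apply: le_trans (ler_normD _ _) _; apply: lerD => //.
have -> : h 1 - h 0 - p * ln b = (ln (1 + b) - ln b) +
    (p - 1) * (ln (b + (p - 1)) - ln b) - (p - 1) * ln (p - 1).
  rewrite /h subrr !mulr0 mulr1 subr0 mulr1 addr0 add0r ln1.
  by ring.
apply: le_trans (ler_normB _ _) _; rewrite lerD2r.
(* As b >= 1, b <= a + b <= (a + 1) b. *)
have D (a : R) : 0 < a -> 0 <= ln (a + b) - ln b <= ln (a + 1).
  move=> a0; rewrite subr_ge0 lerBlDr.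
  rewrite -lnM ?posrE ?addr_gt0//.
  rewrite !ler_ln ?posrE ?addr_gt0 ?mulr_gt0 ?addr_gt0//.
  rewrite lerDr ltW//= mulrDl mul1r lerD2r.
  by rewrite ler_peMr// ltW.
have /andP[d1 d2] := D 1 ltr01.
have /andP[d3 d4] := D (p - 1) pm0.
rewrite subrK in d4; rewrite [b + _]addrC.
rewrite ger0_norm; last by rewrite addr_ge0// mulr_ge0// ltW.
by rewrite lerD// ler_pM2l.
Qed.

End profJ.

(** * The value J(0) in terms of the constant pi_p *)

Section profJ0.
Variables (R : realType) (p : R).
Hypothesis p1 : 1 < p.

Local Notation q := (p / (p - 1)).

Let pm0 : 0 < p - 1. Proof. by rewrite subr_gt0. Qed.
Let p0 : 0 < p. Proof. exact: lt_trans p1. Qed.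
Let qm : q - 1 = q / p. Proof. by field; rewrite !gt_eqF. Qed.

Local Notation N := (profN p 0).

Let N_gt0 (s : R) : s \in `[0, 1] -> 0 < N s.
Proof. exact: profN_gt0. Qed.

(* The substitution t = s / N(s)^(1/p) turns (1 - t^p)^(-1/p) dt into the
   integrand of J(0), up to the factor (p - 1)^(-1/p). *)
Lemma profJ0E : profJ p 0 = (p - 1) `^ p^-1 * (pi_p p / 2).
Proof.
pose tau s := s / N s `^ p^-1.
pose dtau s := (1 - s) `^ (q - 1) * profM p s / (N s `^ p^-1 * N s).
have NE s : N s = s `^ p + (p - 1) * (1 - s) `^ q.
  by rewrite /profN !mul0r addr0.
have pV0 : 0 < p^-1 by rewrite invr_gt0.
have ctau : {within `[0, 1], continuous tau}.
  apply: within_continuousM; first exact: within_continuous_id.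
  apply: within_continuousV.
    by move=> s /N_gt0 N0; rewrite gt_eqF// powR_gt0.
  apply: within_continuous_powR => //; first by move=> s /N_gt0/ltW.
  exact: within_profN.
have tau0 : tau 0 = 0 by rewrite /tau mul0r.
have tau1 : tau 1 = 1.
  rewrite /tau NE subrr powR0 ?mulr0 ?addr0 ?powR1 ?divr1//.
  by rewrite gt_eqF// divr_gt0.
have dtauP (s : R) : s \in `]0, 1[ -> is_derive s 1 tau (dtau s).
  move=> s01; have /N_gt0 N0 := subset_itv_oo_cc s01.
  have s0 : 0 < s by rewrite (itvP s01).
  have x0 : 0 < 1 - s by rewrite subr_gt0 (itvP s01).
  have dN : is_derive s 1 N (p * s `^ (p - 1) - p * (1 - s) `^ (q - 1)).
    rewrite (_ : N = fun s => s `^ p + (p - 1) * (1 - s) `^ q); last first.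
      by apply/funext => y; exact: NE.
    have h1 : is_derive s 1 (@powR R ^~ p) (p * s `^ (p - 1)).
      exact: is_derive1_powR.
    have h2 := @is_derive1_comp _ (@powR R ^~ q) (fun s => 1 - s) s _ _
      (is_derive1_powR q x0)
      (is_deriveB (is_derive_cst (1 : R) s 1) (is_derive_id s (1 : R))).
    have h3 := is_deriveD h1 (is_deriveZ (p - 1) h2).
    apply: is_derive_eq h3 _; rewrite /GRing.scale /=.
    by field; rewrite gt_eqF.
  have dV := @is_derive1_comp _ (@powR R ^~ p^-1) N s _ _
    (is_derive1_powR p^-1 N0) dN.
  have NV0 : N s `^ p^-1 != 0 by rewrite gt_eqF// powR_gt0.
  have h := is_deriveM (is_derive_id s (1 : R))
    (@is_deriveV R (fun s => N s `^ p^-1) s _ 1 NV0 dV).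
  apply: is_derive_eq h _; rewrite /GRing.scale /= ?fctE /dtau.
  have -> : N s `^ (p^-1 - 1) = N s `^ p^-1 / N s.
    by rewrite powRB ?(gt_eqF N0) ?implybT// powRr1// ltW.
  move: N0 NV0; move: (N s `^ p^-1) => NV N0 NV0.
  have e : N s = s * s `^ (p - 1) + (p - 1) * ((1 - s) * (1 - s) `^ (q - 1)).
    rewrite NE !mulr_powRB1 ?(ltW s0) ?(ltW x0)//.
    by rewrite divr_gt0.
  move: N0; rewrite /profM e.
  move: (s `^ _) ((1 - s) `^ _) => sp xq N0.
  by field; rewrite NV0 !gt_eqF.
have dtau0 (s : R) : s \in `]0, 1[ -> 0 < dtau s.
  move=> s01; have s01' := subset_itv_oo_cc s01.
  rewrite /dtau divr_gt0 ?mulr_gt0 ?powR_gt0 ?profM_gt0 ?N_gt0//.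
  by rewrite subr_gt0 (itvP s01).
have [S [S01 [TS ST] cS dS]] := inverse_segment ltr01 ctau dtauP dtau0.
rewrite tau0 tau1 in TS cS dS.
have S0 : S 0 = 0.
  by have := ST 0; rewrite tau0; apply; rewrite in_itv /= lexx ler01.
have S1 : S 1 = 1.
  by have := ST 1; rewrite tau1; apply; rewrite in_itv /= lexx ler01.
pose H := primitive (fun s => profM p s / N s).
have cMN := within_profMN p1 (lexx (0 : R)).
have cH : {within `[0, 1], continuous H} by exact: primitive_continuous.
have dH (s : R) : s \in `]0, 1[ -> is_derive s 1 H (profM p s / N s).
  exact: is_derive_primitive.
pose k := ((p - 1) `^ p^-1)^-1.
have pp0 : 0 < (p - 1) `^ p^-1 by rewrite powR_gt0.
pose f (t : R) := ((1 - t `^ p) `^ p^-1)^-1.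
have f0 (t : R) : t \in `[0, 1[ -> 0 <= f t by rewrite invr_ge0 powR_ge0.
have tp1 (t : R) : t \in `[0, 1[ -> 0 < 1 - t `^ p.
  rewrite in_itv /= => /andP[t0 t1]; rewrite subr_gt0.
  apply: le_lt_trans (t1); apply: powR_le_id => //.
  by rewrite in_itv /= t0 ltW.
have cf : {within `[0, 1[, continuous f}.
  apply: within_continuousV.
    by move=> s /tp1 s1; rewrite gt_eqF// powR_gt0.
  apply: within_continuous_powR => //; first by move=> s /tp1/ltW.
  apply: within_continuousB; first exact: within_continuous_cst.
  apply: within_continuous_powR => //; last exact: within_continuous_id.
  by move=> t; rewrite /= in_itv /= => /andP[].
(* The function k H(S(t)) is the antiderivative of [f] produced by the substitution. It is
   continuous up to t = 1, where [f] is singular. *)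
have cHS : {within `[0, 1], continuous (fun t => k * H (S t))}.
  apply: within_continuousM; first exact: within_continuous_cst.
  by apply: within_continuous_compS cS cH _ => t _; exact: S01.
have dHS (t : R) : t \in `]0, 1[ -> is_derive t 1 (fun t => k * H (S t)) (f t).
  move=> t01; have [Soo dSt] := dS t t01.
  have h := is_deriveZ k (is_derive1_comp (dH _ Soo) dSt).
  apply: is_derive_eq h _; rewrite /GRing.scale /=.
  have S01' := subset_itv_oo_cc Soo; have N0 := N_gt0 S01'.
  have s0 : 0 < S t by rewrite (itvP Soo).
  have x0 : 0 < 1 - S t by rewrite subr_gt0 (itvP Soo).
  have NV0 : 0 < N (S t) `^ p^-1 by exact: powR_gt0.
  have xq0 : 0 < (1 - S t) `^ (q - 1) by exact: powR_gt0.
  have M0 := profM_gt0 p1 S01'.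
  (* The substitution is chosen so that 1 - tau(s)^p = (p-1) (1-s)^q / N(s), whose p-th root is
     explicit. *)
  have fE : f (tau (S t)) =
      N (S t) `^ p^-1 / ((p - 1) `^ p^-1 * (1 - S t) `^ (q - 1)).
    rewrite /f.
    have -> : 1 - tau (S t) `^ p = (p - 1) * (1 - S t) `^ q / N (S t).
      rewrite /tau powRM ?invr_ge0 ?powR_ge0 ?(ltW s0)//.
      rewrite -powRN -powRrM mulNr mulVf ?gt_eqF// powR_inv1 ?(ltW N0)//.
      move: N0; rewrite NE => N0.
      by field; rewrite gt_eqF.
    rewrite !powRM ?invr_ge0 ?mulr_ge0 ?powR_ge0 ?(ltW pm0) ?(ltW N0)//.
    rewrite -[(1 - S t) `^ q `^ _]powRrM -qm.
    rewrite -[(N (S t))^-1]powR_inv1 ?(ltW N0)// -powRrM mulN1r powRN.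
    by rewrite invfM invrK mulrC.
  rewrite TS ?subset_itv_oo_cc// in fE.
  rewrite fE /dtau /k; move: NV0 xq0 M0 N0 pp0.
  move: (N (S t) `^ p^-1) ((1 - S t) `^ (q - 1)) (profM p (S t)) => NV xq M.
  move: (N (S t)) ((p - 1) `^ p^-1) => N' a.
  by move=> *; field; rewrite !gt_eqF.
have := Rintegral_ge0_FTC2 ltr01 f0 cf cHS dHS.
rewrite S0 S1 /H primitive0 mulr0 subr0 -/(profJ p 0) => e.
rewrite /pi_p e mulrAC divff// mul1r /k mulrA divff ?mul1r//.
by rewrite gt_eqF.
Qed.

End profJ0.

(** * Asymptotics of the eigenvalue *)

(** By symmetry b <= a; Bernoulli's inequality at b/a then gives a^p - b^p <= p a^(p-1) (a - b). *)
Lemma powR_lipschitz (R : realType) (p A a b : R) : 1 < p ->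
  0 < a -> a <= A -> 0 < b -> b <= A ->
  `|a `^ p - b `^ p| <= p * A `^ (p - 1) * `|a - b|.
Proof.
move=> p1; have p0 : 0 < p by exact: lt_trans p1.
have pm0 : 0 <= p - 1 by rewrite subr_ge0 ltW.
wlog ba : a b / b <= a => [h a0 aA b0 bA|a0 aA b0 bA].
  have [ba|/ltW ab] := leP b a; first exact: h.
  by rewrite distrC [`|a - b|]distrC; exact: h.
have abp : b `^ p <= a `^ p.
  by apply: ge0_ler_powR => //; rewrite ?nnegrE ?ltW.
rewrite !ger0_norm ?subr_ge0//.
apply: (@le_trans _ _ (p * a `^ (p - 1) * (a - b))).
  have := bernoulli_powR p1 (ltW (divr_gt0 b0 a0)).
  have -> : (b / a) `^ p = b `^ p / a `^ p.
    rewrite powRM ?invr_ge0 ?(ltW a0) ?(ltW b0)// -powR_inv1 ?(ltW a0)//.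
    by rewrite -powRrM mulN1r powRN.
  rewrite ler_pdivlMr ?powR_gt0// -(@mulr_powRB1 _ a)// ?(ltW a0)//.
  have -> : (1 + p * (b / a - 1)) * (a * a `^ (p - 1)) =
    a * a `^ (p - 1) - p * a `^ (p - 1) * (a - b) by field; rewrite gt_eqF.
  by lra.
rewrite ler_wpM2r ?subr_ge0// ler_pM2l//.
by apply: ge0_ler_powR; rewrite // nnegrE ltW// (lt_le_trans a0).
Qed.

Section asymptotics.
Variables (R : realType) (p : R) (n : nat) (K c : R).
Hypotheses (p1 : 1 < p) (n1 : (1 < n)%N) (K0 : K < 0).
Hypothesis cE : c = (n%:R - 1) * Num.sqrt (- K).

Let p0 : 0 < p. Proof. exact: lt_trans p1. Qed.

Let c0 : 0 < c.
Proof. by rewrite cE mulr_gt0 ?sqrtr_gt0 ?oppr_gt0// subr_gt0 ltr1n. Qed.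

Lemma mul_profJ_continuous B :
  {within `[0, B], continuous (fun b => b * profJ p b)}.
Proof.
apply: within_continuousM; first exact: within_continuous_id.
have [C C0 lip] := profJ_lipschitz p1.
apply/within_continuous_epsdelta => t; rewrite /= in_itv /= => /andP[t0 _] e e0.
exists (e / C); first by rewrite divr_gt0.
move=> s; rewrite in_itv /= => /andP[s0 _] se.
by apply: le_lt_trans (lip _ _ s0 t0) _; rewrite mulrC -ltr_pdivlMr.
Qed.

(** The continuous function b J(b) is 0 at b = 0 and unbounded by its logarithmic growth, so the
    intermediate value theorem applies. *)
Lemma mul_profJ_surj y : 0 < y -> exists2 b, 0 < b & b * profJ p b = y.
Proof.
move=> y0; have [C hC] := mul_profJ_ln p1.
have C0 : 0 <= C by apply: le_trans (hC 1 (lexx 1)).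
(* Chosen so that p ln B - C = y. *)
pose B := expR ((y + C) / p).
have B1 : 1 <= B.
  by rewrite -expR0 ler_expR divr_ge0 ?addr_ge0 ?(ltW y0) ?(ltW p0).
have yB : y <= B * profJ p B.
  have := hC B B1; rewrite expRK [p * (_ / p)]mulrC divfK ?gt_eqF//.
  by rewrite ler_norml => /andP[+ _]; lra.
have [|||b] := @IVT R (fun b => b * profJ p b) 0 B y.
- by rewrite (le_trans ler01).
- exact: mul_profJ_continuous.
- have yB0 := le_trans (ltW y0) yB.
  by rewrite mul0r min_l// max_r// (ltW y0) yB.
rewrite in_itv /= => /andP[b0 _] by_; exists b => //.
rewrite lt_def b0 andbT; apply/eqP => bz.
by move: y0; rewrite -by_ bz mul0r ltxx.
Qed.

(** Solving b J(b) = c D and setting eps = b / c makes every D > 0 the length attached to some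
    eps. *)
Lemma lambda_bar_param D : 0 < D -> exists2 eps, 0 < eps &
  D = eps * profJ p (c * eps) /\ lambda_bar p n K D = eps `^ (- p).
Proof.
move=> D0; have [b b0 bD] := mul_profJ_surj (mulr_gt0 c0 D0).
have eps0 : 0 < b / c by rewrite divr_gt0.
have E : D = b / c * profJ p (c * (b / c)).
  rewrite [c * _]mulrC divfK ?gt_eqF// mulrAC bD mulrC mulKf// gt_eqF//.
exists (b / c) => //; split => //.
by rewrite [in LHS]E; move: eps0; rewrite cE => eps0; exact: lambda_barE.
Qed.

(** With r = J(c eps) and I = J(0), the two quantities are r^p / D^p and I^p / D^p. Their difference
    is controlled by |r - I| <= L c eps, and eps <= (2/I) D leaves one power of D to spare. *)
Lemma lambda_bar_small : exists2 C, 0 < C & exists2 d, 0 < d &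
  forall D, 0 < D -> D < d ->
  `|lambda_bar p n K D - (p - 1) * (pi_p p / (2 * D)) `^ p| <=
    C * (D `^ (p - 1))^-1.
Proof.
have [L L0 lip] := profJ_lipschitz p1.
pose I := profJ p 0; have I0 : 0 < I by exact: profJ_gt0.
have Lc0 : 0 < L * c by rewrite mulr_gt0.
(* The bound 1 on eps gives r <= A, and the bound I / (2 L c) gives r >= I/2. *)
pose e0 := Num.min 1 (I / (2 * (L * c))).
have e00 : 0 < e0 by rewrite lt_min ltr01 divr_gt0// mulr_gt0.
pose A := I + L * c.
have A0 : 0 < A by rewrite addr_gt0.
exists (p * A `^ (p - 1) * (L * c) * (2 / I)).
  by do !apply: mulr_gt0 => //; rewrite ?invr_gt0 ?powR_gt0.
(* This is the length attached to [e0]; by monotonicity of b J(b), a smaller D has a smaller eps. *)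
exists (e0 * profJ p (c * e0)).
  by rewrite mulr_gt0 ?profJ_gt0// mulr_ge0 ?(ltW c0) ?(ltW e00).
move=> D D0 Dlt; have [e e_gt0 [DE ->]] := lambda_bar_param D0.
have ee0 : e < e0.
  rewrite ltNge; apply/negP => /(ler_wpM2l (ltW c0)) h.
  have := ler_mul_profJ p1 (mulr_gt0 c0 e00) h.
  by rewrite -(mulrA c e0) -(mulrA c e) ler_pM2l// -DE leNgt Dlt.
move: ee0; rewrite lt_min => /andP[e1]; rewrite ltr_pdivlMr ?mulr_gt0// => eI.
set r := profJ p (c * e).
have ce0 : 0 <= c * e by rewrite mulr_ge0 ?(ltW c0) ?(ltW e_gt0).
have r0 : 0 < r by rewrite profJ_gt0.
have rI : `|r - I| <= L * c * e.
  by have := lip _ 0 ce0 (lexx 0); rewrite subr0 (ger0_norm ce0) mulrA.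
have Lce : L * c * e <= L * c by apply: ler_piMr; exact: ltW.
have rA : r <= A by move: rI; rewrite ler_norml /A => /andP[_]; lra.
have rI2 : I / 2 <= r by move: rI; rewrite ler_norml => /andP[]; lra.
have piE : (p - 1) * (pi_p p / (2 * D)) `^ p = I `^ p / D `^ p.
  have pi0 : 0 <= pi_p p / 2.
    have := I0; rewrite /I profJ0E// pmulr_rgt0 ?powR_gt0 ?subr_gt0//.
    exact: ltW.
  have pm0 : 0 <= p - 1 by rewrite subr_ge0 ltW.
  rewrite invfM mulrA powRM ?invr_ge0 ?(ltW D0)// mulrA.
  have -> : D^-1 `^ p = (D `^ p)^-1.
    by rewrite -(powR_inv1 (ltW D0)) -powRrM mulN1r powRN.
  congr (_ / _).
  rewrite /I profJ0E// (powRM _ (powR_ge0 _ _) pi0) -powRrM.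
  by rewrite mulVf ?gt_eqF// powRr1.
rewrite piE.
have -> : e `^ (- p) = r `^ p / D `^ p.
  rewrite DE -/r powRM ?(ltW e_gt0) ?(ltW r0)// powRN.
  by field; rewrite !gt_eqF ?powR_gt0.
rewrite -mulrBl normrM [`|_^-1|]ger0_norm ?invr_ge0 ?powR_ge0//.
have Dp0 : 0 < D `^ p by rewrite powR_gt0.
rewrite ler_pdivrMr//.
have -> : p * A `^ (p - 1) * (L * c) * (2 / I) * (D `^ (p - 1))^-1 * D `^ p =
    p * A `^ (p - 1) * (L * c * (2 / I * D)).
  rewrite -(@mulr_powRB1 _ D p) ?(ltW D0)//.
  by field; rewrite !gt_eqF ?powR_gt0.
have IA : I <= A by rewrite lerDl ltW.
apply: le_trans (powR_lipschitz p1 r0 rA I0 IA) _.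
rewrite ler_pM2l ?mulr_gt0 ?powR_gt0//; apply: le_trans rI _.
rewrite ler_pM2l// DE -/r mulrCA ler_peMr ?(ltW e_gt0)//.
by rewrite mulrAC ler_pdivlMr// mul1r; lra.
Qed.

(** Here ln lambda = - p ln eps, while c D = b J(b) = p ln(c eps) + O(1) with b = c eps. *)
Lemma lambda_bar_large : exists2 C, 0 < C & exists d, forall D, d < D ->
  `|ln (lambda_bar p n K D) - - c * D| <= C.
Proof.
have [C hC] := mul_profJ_ln p1.
have C0 : 0 <= C by apply: le_trans (hC 1 (lexx 1)).
(* The summand 1 only makes the constant strictly positive. *)
exists (C + p * `|ln c| + 1).
  by rewrite ltr_wpDl// addr_ge0// mulr_ge0// ltW.
(* Beyond this length c D exceeds the value of b J(b) at b = 1, so c eps >= 1 and the logarithmic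
   estimate applies. *)
exists (profJ p 1 / c) => D.
rewrite ltr_pdivrMr// => Dlt.
have J1 : 0 < profJ p 1 by exact: profJ_gt0.
have D0 : 0 < D by rewrite -(pmulr_lgt0 _ c0) (lt_trans J1).
have [e e0 [DE ->]] := lambda_bar_param D0.
have ce0 : 0 < c * e by rewrite mulr_gt0.
have b1 : 1 <= c * e.
  rewrite leNgt; apply/negP => /ltW h; have := ler_mul_profJ p1 ce0 h.
  by rewrite mul1r -(mulrA c e) -DE mulrC leNgt Dlt.
have := hC _ b1; rewrite -(mulrA c e) -DE lnM ?posrE// => h.
rewrite ln_powR.
have -> : - p * ln e - - c * D = (c * D - p * (ln c + ln e)) + p * ln c by ring.
apply: le_trans (ler_normD _ _) _; rewrite normrM (gtr0_norm p0).
by rewrite -addrA lerD// lerDl.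
Qed.

End asymptotics.

Theorem theorem1p4 (R : realType) (p : R) (n : nat) (K : R)
    (hp : 1 < p) (hn : (2 <= n)%N) (hK : K < 0) :
  (fun D : R => lambda_bar p n K D)
    = (fun D : R => (p - 1) * (pi_p p / (2 * D)) `^ p)
      +O_ (0^'+) (fun D : R => (D `^ (p - 1))^-1)
  /\
  (fun D : R => ln (lambda_bar p n K D))
    = (fun D : R => - ((n%:R - 1) * Num.sqrt (- K)) * D)
      +O_ (pinfty_nbhs R) (fun=> 1 : R).
Proof.
split; apply/eqaddOP/bigO_exP.
- have [C C0 [d d0 h]] := lambda_bar_small hp hn hK erefl.
  exists C => //; exists d => // D /=; rewrite sub0r normrN => Dd D0.
  rewrite [X in _ <= C * X]ger0_norm ?invr_ge0 ?powR_ge0//.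
  by apply: h => //; exact: le_lt_trans (ler_norm _) Dd.
- have [C C0 [d h]] := lambda_bar_large hp hn hK erefl.
  exists C => //; exists d; split; first exact: num_real.
  by move=> D dD; rewrite normr1 mulr1; exact: h.
Qed.
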